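(* Let $N\ge1$ be an integer, $s\in(0,1)$, $q\in(1,2)$, and let $\Omega\subset\mathbb{R}^N$ be a bounded open set with $C^{1,1}$ boundary. Then there exists $\delta>0$, depending only on $s$, $q$, $\Omega$ and $N$, such that every critical point $u\in\mathcal{D}^{s,2}_0(\Omega)$, $u\ne w_{\Omega,s,q}$, of the functional $$u\mapsto\frac12\int_{\mathbb{R}^N}\int_{\mathbb{R}^N}\frac{(u(x)-u(y))^2}{|x-y|^{N+2s}}\,dx\,dy-\frac1q\int_\Omega|u|^q\,dx$$ on $\mathcal{D}^{s,2}_0(\Omega)$ satisfies $\|u-w_{\Omega,s,q}\|_{L^1(\Omega)}\ge\delta$.
   Context: For a function $u$ on $\mathbb{R}^N$ write $[u]^2=\int_{\mathbb{R}^N}\int_{\mathbb{R}^N}\frac{(u(x)-u(y))^2}{|x-y|^{N+2s}}\,dx\,dy$. Functions in $C_0^\infty(\Omega)$ (smooth, compactly supported in $\Omega$) are extended by $0$ to $\mathbb{R}^N\setminus\Omega$. $\mathcal{D}^{s,2}_0(\Omega)$ is the completion of $C_0^\infty(\Omega)$ with respect to the norm $[\cdot]$; for bounded $\Omega$ it is identified with a space of functions continuously embedded in $L^q(\Omega)$, extended by $0$ outside $\Omega$. The $(s,q)$-Lane-Emden density $w_{\Omega,s,q}$ is the unique solution of $$\min\Big\{\tfrac12[\varphi]^2-\tfrac1q\int_\Omega\varphi^q\,dx:\ \varphi\in\mathcal{D}^{s,2}_0(\Omega),\ \varphi\ge0\text{ a.e. in }\Omega\Big\}.$$ Critical points of the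 functional are the $u\in\mathcal{D}^{s,2}_0(\Omega)$ with $\int_{\mathbb{R}^N}\int_{\mathbb{R}^N}\frac{(u(x)-u(y))(\varphi(x)-\varphi(y))}{|x-y|^{N+2s}}\,dx\,dy=\int_\Omega|u|^{q-2}u\varphi\,dx$ for all $\varphi\in\mathcal{D}^{s,2}_0(\Omega)$. *)

(* Defs.v *)
From HB Require Import structures.
From mathcomp Require Import all_boot all_order all_algebra.
From mathcomp Require Import all_classical all_reals all_analysis.

Set Implicit Arguments.
Unset Strict Implicit.
Unset Printing Implicit Defensive.

Import Order.TTheory GRing.Theory Num.Theory.
Import numFieldNormedType.Exports.

Local Open Scope classical_set_scope.
Local Open Scope ring_scope.

Definition measure_rV_display : measure_display -> measure_display.
Proof. exact. Qed.

Section measurable_rV.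
Context {d} {T : measurableType d}.
Variable n : nat.

Let coord (i : 'I_n) (x : 'rV[T]_n) : T := x ord0 i.

Let rV_set0 : g_sigma_preimage coord set0.
Proof. exact: sigma_algebra0. Qed.

Let rV_setC A : g_sigma_preimage coord A -> g_sigma_preimage coord (~` A).
Proof. exact: sigma_algebraC. Qed.

Let rV_bigcup (F : _^nat) : (forall i, g_sigma_preimage coord (F i)) ->
  g_sigma_preimage coord (\bigcup_i (F i)).
Proof. exact: sigma_algebra_bigcup. Qed.

HB.instance Definition _ := @isMeasurable.Build (measure_rV_display d)
  'rV[T]_n (g_sigma_preimage coord) rV_set0 rV_setC rV_bigcup.

Lemma measurable_coord (i : 'I_n) :
  measurable_fun [set: 'rV[T]_n] (fun x : 'rV[T]_n => x ord0 i).
Proof.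
move=> _ Y mY; rewrite setTI; apply: sub_sigma_algebra => /=.
rewrite -bigcup_seq/=; exists i => /=; first by rewrite mem_index_enum.
by exists Y => //; rewrite setTI.
Qed.

Lemma measurable_fun_rVP d1 (T1 : measurableType d1) (f : T1 -> 'rV[T]_n) :
  (forall i, measurable_fun [set: T1] (fun x => f x ord0 i)) ->
  measurable_fun [set: T1] f.
Proof.
move=> mf.
suff sub : <<s \big[setU/set0]_(i < n)
    preimage_set_system setT (coord i) measurable >> `<=`
    [set A | measurable (f @^-1` A)].
  by move=> _ A mA; rewrite setTI; exact: sub.
apply: smallest_sub; first split => /=.
- by rewrite preimage_set0; exact: measurable0.
- by move=> A mA; rewrite setTD preimage_setC; exact: measurableC.
- by move=> F mF; rewrite preimage_bigcup; exact: bigcupT_measurable.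
- move=> A; rewrite -bigcup_seq/= => -[i _ [B mB <-]] /=.
  by rewrite setTI; have := mf i measurableT B mB; rewrite setTI.
Qed.

End measurable_rV.

Section lebesgue_rV.
Context {R : realType}.

Definition consrV n (x : R * 'rV[R]_n) : 'rV[R]_n.+1 :=
  \row_i (if unlift ord0 i is Some j then x.2 ord0 j else x.1).

Definition unconsrV n (x : 'rV[R]_n.+1) : R * 'rV[R]_n :=
  (x ord0 ord0, \row_j x ord0 (lift ord0 j)).

Lemma consrVK n : cancel (@consrV n) (@unconsrV n).
Proof.
case=> a v; rewrite /unconsrV /consrV !mxE unlift_none; congr pair.
by apply/rowP => j; rewrite !mxE liftK.
Qed.

Lemma unconsrVK n : cancel (@unconsrV n) (@consrV n).
Proof.
move=> x; apply/rowP => i; rewrite !mxE.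
by case: unliftP => [j ->|->] //=; rewrite mxE.
Qed.

Lemma measurable_consrV n : measurable_fun [set: R * 'rV[R]_n] (@consrV n).
Proof.
apply: measurable_fun_rVP => i.
under eq_fun do rewrite mxE.
case: (unlift ord0 i) => [j|]; last exact: measurable_fst.
exact: (measurableT_comp (measurable_coord j)) measurable_snd.
Qed.

Lemma measurable_unconsrV n : measurable_fun [set: 'rV[R]_n.+1] (@unconsrV n).
Proof.
apply: measurable_fun_pair; first exact: (measurable_coord ord0).
apply: measurable_fun_rVP => i.
under eq_fun do rewrite mxE.
exact: (measurable_coord (lift ord0 i)).
Qed.

Section step.
Variables (n : nat) (mu : {sigma_finite_measure set 'rV[R]_n -> \bar R}).

Definition lebesgue_rVS : set 'rV[R]_n.+1 -> \bar R :=
  pushforward (@lebesgue_measure R \x mu)%E (@consrV n).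

Let lebesgue_rVS0 : lebesgue_rVS set0 = 0%E.
Proof. by rewrite /lebesgue_rVS /pushforward preimage_set0 measure0. Qed.

Let lebesgue_rVS_ge0 A : (0 <= lebesgue_rVS A)%E.
Proof. by rewrite /lebesgue_rVS /pushforward measure_ge0. Qed.

Let lebesgue_rVS_sigma_additive : semi_sigma_additive lebesgue_rVS.
Proof.
move=> F mF tF mUF; rewrite /lebesgue_rVS /pushforward preimage_bigcup.
apply: measure_semi_sigma_additive.
- by move=> k; rewrite -[X in measurable X]setTI; exact: measurable_consrV.
- apply/trivIsetP => i j _ _ ij; rewrite -preimage_setI.
  by move/trivIsetP : tF => /(_ _ _ _ _ ij) ->//; rewrite preimage_set0.
- rewrite -preimage_bigcup -[X in measurable X]setTI.
  exact: measurable_consrV.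
Qed.

HB.instance Definition _ := isMeasure.Build _ _ _ lebesgue_rVS
  lebesgue_rVS0 lebesgue_rVS_ge0 lebesgue_rVS_sigma_additive.

Let lebesgue_rVS_sigma_finite : sigma_finite setT lebesgue_rVS.
Proof.
have /sigma_finiteP[F [TF ndF Foo]] := sigma_finiteT (@lebesgue_measure R).
have /sigma_finiteP[G [TG ndG Goo]] := sigma_finiteT mu.
exists (fun k => @unconsrV n @^-1` (F k `*` G k)).
  rewrite -preimage_bigcup; apply/esym; rewrite -subTset => x _.
  have [i _ Fi] : (\bigcup_i F i) (unconsrV x).1 by rewrite -TF.
  have [j _ Gj] : (\bigcup_i G i) (unconsrV x).2 by rewrite -TG.
  exists (maxn i j) => //; split.
    by move: Fi; exact/subsetPset/ndF/leq_maxl.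
  by move: Gj; exact/subsetPset/ndG/leq_maxr.
move=> k; have [mF Fk] := Foo k; have [mG Gk] := Goo k; split.
  rewrite -[X in measurable X]setTI; apply: measurable_unconsrV => //.
  exact: measurableX.
rewrite /lebesgue_rVS /pushforward -comp_preimage.
rewrite (_ : _ \o _ = id); last by apply/funext => x /=; rewrite consrVK.
by rewrite preimage_id product_measure1E// lte_mul_pinfty// ge0_fin_numE.
Qed.

HB.instance Definition _ := Measure_isSigmaFinite.Build _ _ _ lebesgue_rVS
  lebesgue_rVS_sigma_finite.

End step.

Fixpoint lebesgue_rV n : {sigma_finite_measure set 'rV[R]_n -> \bar R} :=
  match n with
  | 0 => dirac (0 : 'rV[R]_0)
  | m.+1 => lebesgue_rVS (lebesgue_rV m)
  end.

End lebesgue_rV.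

Lemma lebesgue_rV_box (R : realType) n (A : 'I_n -> set R) :
  (forall i, measurable (A i)) ->
  lebesgue_rV n [set x : 'rV[R]_n | forall i, A i (x ord0 i)] =
  (\prod_(i < n) lebesgue_measure (A i))%E.
Proof.
elim: n A => [|n IHn] A mA.
  by rewrite big_ord0 /= diracE mem_set// => -[].
have mB : measurable [set x : 'rV[R]_n | forall i, A (lift ord0 i) (x ord0 i)].
  rewrite (_ : [set x | _] =
    \big[setI/setT]_(i < n) ((fun x : 'rV[R]_n => x ord0 i) @^-1`
       A (lift ord0 i))).
    apply: bigsetI_measurable => i _.
    by rewrite -[X in measurable X]setTI; exact: measurable_coord.
  rewrite -bigcap_seq; apply/seteqP; split => [x /= Ax i _|x /= Ax i].
    exact: Ax.
  by apply: (Ax i); rewrite /= mem_index_enum.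
rewrite big_ord_recl -IHn// -(product_measure1E lebesgue_measure)//=.
rewrite /lebesgue_rVS /pushforward; congr (product_measure1 _ _ _).
apply/seteqP; split => [[a v] /= Av|[a v] /= [Aa Av] i].
  split; first by have := Av ord0; rewrite mxE unlift_none.
  by move=> i; have := Av (lift ord0 i); rewrite mxE liftK.
by rewrite mxE; case: unliftP => [j ->|->].
exact: mA.
Qed.

Section calculus.
Context {R : realType}.

(* The canonical norm on ['rV[R]_n] is the sup norm. *)
Definition euclidean_norm n (x : 'rV[R]_n) : R :=
  Num.sqrt (\sum_(i < n) x ord0 i ^+ 2).

Definition partial n (i : 'I_n) (f : 'rV[R]_n -> R) : 'rV[R]_n -> R :=
  fun x => 'D_(delta_mx ord0 i) f x.

Definition smooth n (f : 'rV[R]_n -> R) : Prop :=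
  forall l : seq 'I_n, let g := foldr (@partial n) f l in
    continuous g /\ forall i x, derivable g x (delta_mx ord0 i).

Definition test_function n (Omega : set 'rV[R]_n) (f : 'rV[R]_n -> R) : Prop :=
  let supp := closure [set x | f x != 0] in
  [/\ smooth f, compact supp & supp `<=` Omega].

Definition C11_function n (g : 'rV[R]_n -> R) : Prop :=
  forall i : 'I_n, (forall x, derivable g x (delta_mx ord0 i)) /\
    lipschitz (partial i g).

(* Near each boundary point, after an orthogonal change of coordinates
   [y = x *m Q], the set is the strict epigraph [y_k > g (y without y_k)] of a
   C^{1,1} function of the other coordinates. *)
Definition C11_boundary n (Omega : set 'rV[R]_n) : Prop :=
  forall x0, (closure Omega `\` interior Omega) x0 ->
  exists (Q : 'M[R]_n) (k : 'I_n) (g : 'rV[R]_n.-1 -> R),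
    [/\ Q *m Q^T = 1%:M, C11_function g &
      \forall x \near x0,
        Omega x <-> g (col' k (x *m Q)) < (x *m Q) ord0 k].

End calculus.

Section lane_emden.
Context {R : realType} {N : nat}.
Variables (s q : R) (Omega : set 'rV[R]_N).
Implicit Types u v w phi : 'rV[R]_N -> R.

Let leb := @lebesgue_rV R N.

(* The diagonal is a null set; there the quotient is [0 / 0 = 0]. *)
Definition gagliardo_form u v : \bar R :=
  (\int[leb \x leb]_z
    ((u z.1 - u z.2) * (v z.1 - v z.2) /
     euclidean_norm (z.1 - z.2) `^ (N%:R + 2 * s))%:E)%E.

Definition gagliardo_sq u : \bar R :=
  (\int[leb \x leb]_z
    ((u z.1 - u z.2) ^+ 2 /
     euclidean_norm (z.1 - z.2) `^ (N%:R + 2 * s))%:E)%E.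

Definition gagliardo_cauchy (f : nat -> 'rV[R]_N -> R) : Prop :=
  forall e : R, 0 < e -> exists n0, forall m n, (n0 <= m)%N -> (n0 <= n)%N ->
    (gagliardo_sq (f m \- f n)%R < (e ^+ 2)%:E)%E.

(* An element of the completion is the class of a Cauchy sequence of test
   functions; it is identified with the limit of that sequence in
   [L^q(Omega)], extended by 0. *)
Definition D0s2 u : Prop :=
  [/\ measurable_fun [set: 'rV[R]_N] u,
      (forall x, ~ Omega x -> u x = 0) &
      exists f : nat -> 'rV[R]_N -> R,
        [/\ forall n, test_function Omega (f n),
            gagliardo_cauchy f &
            (fun n => \int[leb]_(x in Omega) (`|f n x - u x| `^ q)%:E)%E
              @ \oo --> 0%E]].

Definition lane_emden_energy phi : \bar R :=
  ((2^-1)%:E * gagliardo_sq phi -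
   (q^-1)%:E * \int[leb]_(x in Omega) (phi x `^ q)%:E)%E.

Definition lane_emden_admissible phi : Prop :=
  D0s2 phi /\ \forall x \ae leb, Omega x -> 0 <= phi x.

Definition lane_emden_density w : Prop :=
  lane_emden_admissible w /\
  forall phi, lane_emden_admissible phi ->
    (lane_emden_energy w <= lane_emden_energy phi)%E.

Definition critical_point u : Prop :=
  D0s2 u /\
  forall phi, D0s2 phi ->
    gagliardo_form u phi =
    (\int[leb]_(x in Omega) (`|u x| `^ (q - 2) * u x * phi x)%:E)%E.

End lane_emden.

(* Main.v *)
Require Import Defs.
From HB Require Import structures.
From mathcomp Require Import all_boot all_order all_algebra.
From mathcomp Require Import all_classical all_reals all_analysis.
From mathcomp Require Import measurable_realfun.
From mathcomp Require Import ring lra.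

Set Implicit Arguments.
Unset Strict Implicit.
Unset Printing Implicit Defensive.

Import Order.TTheory GRing.Theory Num.Theory.
Import numFieldNormedType.Exports.

Local Open Scope classical_set_scope.
Local Open Scope ring_scope.

(** A critical point that is close to the density [w] in L^1 must be nonnegative,
    and a nonnegative critical point that does not vanish must be [w].  Write [K]
    for the kernel [|x - y|^(- N - 2 s)] and [E(u)] for the double integral of
    [(u x - u y)^2 K].

    Sign.  Let [p] and [m] be the positive and negative parts of a critical
    point [u].  Testing the equation with [m] gives
      [E(m) + 2 * int int p(x) m(y) K = int m^q]   (critical_neg_balance).
    The interaction term is where nonlocality enters: [K] is bounded below on the
    bounded set [Omega], so the term is at least a multiple of [|p|_1 |m|_1]
    (interaction_lower_bound).  If [u] is L^1-close to [w], then [|p|_1] is at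
    least [|w|_1 / 2] while [|m|_1] is small.  But an inequality
    [E(m) + c |m|_1 <= int m^q] with [|m|_1] small forces [m = 0] (small_mass).
    Indeed [m^q <= eta^(q-1) m] where [m <= eta], which the linear term absorbs;
    and the set where [m] is not small has so little measure that around each
    of its points at least half of a small cube lies outside it, so that the inner
    integral of [(m(x) - m(y))^2 K] at such a point already dominates [m(x)^q].

    Uniqueness.  Nonnegative critical points and (absolute values of) densities
    are both of the following kind: functions [z >= 0] with
    [int z^(q-1) phi <= <z, phi>] for all [phi >= 0] and [E(z) <= int z^q], where
    [<., .>] is the bilinear form of [E] (supersolution).
    The energy is convex along the curve [sqrt(z^2 + t b^2)]; testing with this
    curve and letting [t] tend to 0 gives Picone's inequality
    [int z^(q-2) b^2 <= E(b)] (picone).  If [b] is of the same kind, adding this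
    to the inequality with [z] and [b] exchanged yields
    [int (z^(q-2) - b^(q-2)) (b^2 - z^2) <= 0], whose integrand is nonnegative
    and vanishes only where [z = b], because [q < 2] (supersolution_unique).
    That the zero sets of [z] and [b] agree is a strong maximum principle, again
    read off the interaction term (strong_maximum).

    Admissible test functions.  These arguments test with [m], [|u|],
    [(b - l z)^+] and [sqrt(z^2 + t b^2)], which belong to the energy space
    although it is defined through smooth functions.  The key is that a function
    that is an L^q limit of test functions of bounded energy is in the space
    (approximable_D0s2): among the test functions at distance at most [1 / n]
    choose one of almost minimal energy; by the parallelogram identity these form
    a Cauchy sequence.  For [sqrt(u^2 + v^2)] the approximants are
    [sqrt(f^2 + g^2 + e^2) - e].  Energies of test functions never have to be
    estimated: a critical point has finite energy by its equation, a density by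
    comparison with 0, and then so do the approximants, by lower semicontinuity.

    Uniformity.  The radius so obtained depends on [w] through [|w|_1] only, and two
    densities agree almost everywhere as soon as one of them does not vanish.  If
    a density vanishes, so does every critical point [u], since the energy of
    [|u|] would otherwise be negative, hence below the minimum; then any radius
    will do. *)

(** * Smooth functions and test functions *)

Section smooth_calculus.
Context {R : realType} {n : nat}.
Implicit Types f g S : 'rV[R]_n -> R.

(** Exhibiting a class that is stable under partial derivatives replaces any
    formula for iterated derivatives. *)
Lemma smooth_coind (F : ('rV[R]_n -> R) -> Prop) :
  (forall f, F f -> [/\ continuous f,
    forall i x, derivable f x (delta_mx ord0 i) & forall i, F (partial i f)]) ->
  forall f, F f -> smooth f.
Proof.
move=> FP f Ff l; suff /FP[cf df _] : F (foldr (@partial R n) f l) by [].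
by elim: l => //= i l /FP[_ _]; exact.
Qed.

Lemma smooth_continuous f : smooth f -> continuous f.
Proof. by move=> /(_ [::])[]. Qed.

Lemma smooth_derivable f : smooth f ->
  forall i x, derivable f x (delta_mx ord0 i).
Proof. by move=> /(_ [::])[]. Qed.

Lemma smooth_partial f i : smooth f -> smooth (partial i f).
Proof. by move=> sf l; have := sf (rcons l i); rewrite foldr_rcons. Qed.

Lemma smooth_cst c : smooth (cst c : 'rV[R]_n -> R).
Proof.
apply: (smooth_coind (F := fun f => exists c, f = cst c)); last by exists c.
move=> f [{}c ->]; split.
- exact: cst_continuous.
- by move=> i x; exact: derivable_cst.
- by move=> i; exists 0; apply/funext => x; rewrite /partial derive_cst.
Qed.

Lemma derive_line f x v : 'D_v f x = 'D_1 (fun h : R => f (h *: v + x)) 0.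
Proof.
rewrite /derive.
set g1 := fun h => h^-1 *: _; set g2 := fun h => h^-1 *: _.
suff -> : g1 = g2 by [].
by rewrite funeqE /g1 /g2 => h /=; rewrite addr0 scale0r add0r [_%:A]mulr1.
Qed.

Definition invsqrt S : 'rV[R]_n -> R := fun x => (Num.sqrt (S x))^-1.

Lemma is_derive_invsqrt S x v : 0 < S x -> derivable S x v ->
  is_derive x v (invsqrt S) (- 2^-1 * ('D_v S x * invsqrt S x ^+ 3)).
Proof.
move=> S0 dS.
have dSq : is_derive x v (Num.sqrt \o S) ((2 * Num.sqrt (S x))^-1 * 'D_v S x).
  have d1 : is_derive (0 : R) 1 (fun h : R => S (h *: v + x)) ('D_v S x).
    by rewrite derive_line; apply: derivableP; exact: (derivable1P _ _ _).1.
  have S0' : 0 < S ((0 : R) *: v + x) by rewrite scale0r add0r.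
  have := @is_derive1_comp _ Num.sqrt (fun h : R => S (h *: v + x)) 0 _ _
    (is_derive1_sqrt S0') d1.
  rewrite scale0r add0r => -[d2 d2E]; apply: DeriveDef.
    by apply: (derivable1P _ _ _).2; exact: d2.
  by rewrite (derive_line (Num.sqrt \o S)); exact: d2E.
have Sq0 : (Num.sqrt \o S) x != 0 by rewrite /= gt_eqF// sqrtr_gt0.
have [dq qE] := dSq.
apply: DeriveDef; first exact: derivableV.
rewrite deriveV// qE /invsqrt /=.
rewrite invfM exprVn /GRing.scale /=.
move: Sq0 => /=.
set a := Num.sqrt _ => a0.
by field.
Qed.

Variable S : 'rV[R]_n -> R.
Hypotheses (S_gt0 : forall x, 0 < S x) (smooth_S : smooth S).

(** The algebra generated by the smooth functions and [1 / sqrt S] is stable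
    under partial derivatives, since [d (1 / sqrt S) = - dS (1 / sqrt S)^3 / 2].
    The square root itself is then [S * (1 / sqrt S)]. *)
Inductive sqrt_algebra : ('rV[R]_n -> R) -> Prop :=
| sqrt_algebra_smooth f : smooth f -> sqrt_algebra f
| sqrt_algebra_add f g : sqrt_algebra f -> sqrt_algebra g ->
    sqrt_algebra (f + g)
| sqrt_algebra_mul f g : sqrt_algebra f -> sqrt_algebra g ->
    sqrt_algebra (f * g)
| sqrt_algebra_invsqrt : sqrt_algebra (invsqrt S).

Lemma continuous_invsqrt : continuous (invsqrt S).
Proof.
move=> x; have S0 : Num.sqrt (S x) != 0 by rewrite gt_eqF// sqrtr_gt0.
have c : {for x, continuous (Num.sqrt \o S)}.
  apply: continuous_comp; first exact: smooth_continuous.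
  exact: sqrt_continuous.
exact: (cvgV S0 c).
Qed.

Lemma sqrt_algebra_partial f : sqrt_algebra f -> [/\ continuous f,
    forall i x, derivable f x (delta_mx ord0 i) &
    forall i, sqrt_algebra (partial i f)].
Proof.
elim=> {f} [f sf|f g af [cf df pf] ag [cg dg pg]|
           f g af [cf df pf] ag [cg dg pg]|].
- split; [exact: smooth_continuous|exact: smooth_derivable|].
  by move=> i; apply: sqrt_algebra_smooth; exact: smooth_partial.
- split.
  + by move=> x; exact: (cvgD (cf x) (cg x)).
  + by move=> i x; exact: derivableD.
  + move=> i; rewrite (_ : partial i (f + g) = partial i f + partial i g).
      exact: sqrt_algebra_add.
    by apply/funext => x; rewrite /partial deriveD.
- split.
  + by move=> x; exact: (cvgM (cf x) (cg x)).
  + by move=> i x; exact: derivableM.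
  + move=> i; rewrite (_ : partial i (f * g) =
      f * partial i g + g * partial i f).
      by apply: sqrt_algebra_add; exact: sqrt_algebra_mul.
    by apply/funext => x; rewrite /partial deriveM.
- have dP i x := is_derive_invsqrt (S_gt0 x) (@smooth_derivable S smooth_S i x).
  split.
  + exact: continuous_invsqrt.
  + by move=> i x; have [] := dP i x.
  + move=> i; rewrite (_ : partial i (invsqrt S) = cst (- 2^-1) *
      (partial i S * (invsqrt S * (invsqrt S * invsqrt S)))).
      apply: sqrt_algebra_mul.
        by apply: sqrt_algebra_smooth; exact: smooth_cst.
      apply: sqrt_algebra_mul.
        by apply: sqrt_algebra_smooth; exact: smooth_partial.
      by do ?[apply: sqrt_algebra_mul|exact: sqrt_algebra_invsqrt].
    by apply/funext => x; rewrite /partial; have [_ ->] := dP i x.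
Qed.

Lemma smooth_sqrt_algebra f : sqrt_algebra f -> smooth f.
Proof. by apply: smooth_coind; exact: sqrt_algebra_partial. Qed.

Lemma smooth_sqrt : smooth (fun x => Num.sqrt (S x)).
Proof.
rewrite (_ : (fun x => _) = S * invsqrt S).
  apply: smooth_sqrt_algebra; apply: sqrt_algebra_mul.
    exact: sqrt_algebra_smooth.
  exact: sqrt_algebra_invsqrt.
apply/funext => x; rewrite /GRing.mul /= /invsqrt -{2}(@sqr_sqrtr _ (S x)).
  by rewrite expr2 mulfK// gt_eqF// sqrtr_gt0.
exact: ltW.
Qed.

End smooth_calculus.

Section test_functions.
Context {R : realType} {n : nat}.
Implicit Types f g : 'rV[R]_n -> R.

Lemma smooth_add f g : smooth f -> smooth g -> smooth (f \+ g).
Proof.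
move=> sf sg; apply: (smooth_sqrt_algebra (S := cst 1) (fun=> ltr01)
  (smooth_cst 1)).
by apply: sqrt_algebra_add; exact: sqrt_algebra_smooth.
Qed.

Lemma smooth_mul f g : smooth f -> smooth g -> smooth (f \* g).
Proof.
move=> sf sg; apply: (smooth_sqrt_algebra (S := cst 1) (fun=> ltr01)
  (smooth_cst 1)).
by apply: sqrt_algebra_mul; exact: sqrt_algebra_smooth.
Qed.

Lemma smooth_scale c f : smooth f -> smooth (c \*o f).
Proof. move=> sf; exact: (smooth_mul (smooth_cst c) sf). Qed.

Variable Omega : set 'rV[R]_n.

Lemma test_function_smooth f : test_function Omega f -> smooth f.
Proof. by case. Qed.

Lemma test_function_out f x : test_function Omega f -> ~ Omega x -> f x = 0.
Proof.
move=> [_ _ sub] nO; apply/eqP; apply: contrapT => /negP f0.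
by apply: nO; apply: sub; exact: subset_closure.
Qed.

Lemma test_function_combine (h : 'rV[R]_n -> R) f g :
  test_function Omega f -> test_function Omega g -> smooth h ->
  (forall x, f x = 0 -> g x = 0 -> h x = 0) -> test_function Omega h.
Proof.
move=> [_ kf sf] [_ kg sg] sh h0.
have sub : closure [set x | h x != 0] `<=`
    closure [set x | f x != 0] `|` closure [set x | g x != 0].
  rewrite -closureU; apply: closure_subset => x /= hx.
  have [fx|] := eqVneq (f x) 0; [right|by left].
  by apply: contra_neq hx => gx; exact: h0.
split => //.
- apply: subclosed_compact sub; first exact: closed_closure.
  exact: compactU.
- by apply: subset_trans sub _; rewrite subUset.
Qed.

Lemma test_function0 : test_function Omega (cst 0).
Proof.
have E : [set x : 'rV[R]_n | (cst 0 x : R) != 0] = set0.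
  by apply/seteqP; split => x //=; rewrite eqxx.
by split; [exact: smooth_cst|rewrite /= E closure0; exact: compact0|
  rewrite /= E closure0].
Qed.

Lemma test_function_add f g : test_function Omega f -> test_function Omega g ->
  test_function Omega (f \+ g).
Proof.
move=> tf tg; apply: (test_function_combine tf tg).
  by apply: smooth_add; exact: test_function_smooth.
by move=> x /= -> ->; rewrite addr0.
Qed.

Lemma test_function_scale c f : test_function Omega f ->
  test_function Omega (c \*o f).
Proof.
move=> tf; apply: (test_function_combine tf tf).
  by apply: smooth_scale; exact: test_function_smooth.
by move=> x /= -> _; rewrite mulr0.
Qed.

(** Subtracting [e] makes the smoothed modulus vanish outside the supports. *)
Lemma test_function_hypot e f g : 0 < e ->
  test_function Omega f -> test_function Omega g ->
  test_function Omega
    (fun x => Num.sqrt (f x ^+ 2 + g x ^+ 2 + e ^+ 2) - e).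
Proof.
move=> e0 tf tg; apply: (test_function_combine tf tg); last first.
  by move=> x -> ->; rewrite expr0n /= !add0r sqrtr_sqr gtr0_norm// subrr.
have [sf sg] := (test_function_smooth tf, test_function_smooth tg).
apply: (@smooth_add _ (cst (- e))); last exact: smooth_cst.
apply: (@smooth_sqrt _ _ (fun x => f x ^+ 2 + g x ^+ 2 + e ^+ 2)).
  move=> x; rewrite ltr_wpDl ?exprn_gt0// addr_ge0// sqr_ge0//.
apply: (@smooth_add _ (cst (e ^+ 2))); last exact: smooth_cst.
apply: (@smooth_add (fun x => f x ^+ 2) (fun x => g x ^+ 2)).
  by rewrite (_ : (fun x => _) = f \* f); [exact: smooth_mul|apply/funext].
by rewrite (_ : (fun x => _) = g \* g); [exact: smooth_mul|apply/funext].
Qed.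

End test_functions.

(** * Borel sets and cubes in R^N *)

Section borel_rV.
Context {R : realType} {n : nat}.
Implicit Types U : set 'rV[R]_n.

Lemma measurable_box (A : 'I_n -> set R) : (forall i, measurable (A i)) ->
  measurable [set x : 'rV[R]_n | forall i, A i (x ord0 i)].
Proof.
move=> mA; rewrite (_ : [set x | _] =
    \big[setI/setT]_(i < n) ((fun x : 'rV[R]_n => x ord0 i) @^-1` A i)).
  apply: bigsetI_measurable => i _.
  by rewrite -[X in measurable X]setTI; exact: measurable_coord.
rewrite -bigcap_seq; apply/seteqP; split => [x /= Ax i _|x /= Ax i].
  exact: Ax.
by apply: (Ax i); rewrite /= mem_index_enum.
Qed.

Let box (p : 'rV[rat]_n * nat) : set 'rV[R]_n :=
  [set x | forall i, ball (ratr (p.1 ord0 i) : R) p.2.+1%:R^-1 (x ord0 i)].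

(** The sigma-algebra generated by the coordinates is the Borel one: an open
    set is a countable union of boxes with rational centres. *)
Lemma open_measurable_rV U : open U -> measurable U.
Proof.
move=> oU.
have -> : U = \bigcup_(p : 'rV[rat]_n * nat)
    (if `[< box p `<=` U >] then box p else set0).
  apply/seteqP; split => [x Ux|x [p _]]; last first.
    by case: ifPn => // /asboolP; exact.
  have := oU; rewrite openE => /(_ _ Ux) /nbhs_ballP[e /= e0 xeU].
  have [k ke] : exists k : nat, k.+1%:R^-1 < e / 2.
    have [k _ /(_ k (leqnn _))] := near_infty_natSinv_lt (PosNum (divr_gt0 e0
      (ltr0Sn _ 1))).
    by exists k.
  have k0 : 0 < k.+1%:R^-1 :> R by rewrite invr_gt0.
  have /choice[c cP] : forall i : 'I_n, exists c : rat,
      `|x ord0 i - ratr c| < k.+1%:R^-1.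
    move=> i; have : x ord0 i - k.+1%:R^-1 < x ord0 i + k.+1%:R^-1.
      by rewrite ltrD2l gtrN.
    move=> /rat_in_itvoo[c]; rewrite in_itv /= => /andP[c1 c2]; exists c.
    by rewrite distrC ltr_distl c1 c2.
  exists (\row_i c i, k) => //; rewrite asboolT.
    by move=> i /=; rewrite mxE /ball/= distrC; exact: cP.
  move=> y /= yb; apply: xeU; split => // i j; rewrite !ord1.
  have yj : `|ratr (c j) - y ord0 j| < k.+1%:R^-1 by have := yb j; rewrite mxE.
  rewrite /ball/=.
  rewrite (_ : x ord0 j - y ord0 j = (x ord0 j - ratr (c j)) +
    (ratr (c j) - y ord0 j)); last by ring.
  by apply: le_lt_trans (ler_normD _ _) _; have := cP j; move: yj ke;
    set a := k.+1%:R^-1; lra.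
apply: countable_bigcupT_measurable; first exact: countableP.
move=> p; case: ifP => _; last exact: measurable0.
apply: (@measurable_box (fun i => ball (ratr (p.1 ord0 i) : R) p.2.+1%:R^-1)).
by move=> i; apply: open_measurable; exact: ball_open.
Qed.

Lemma continuous_measurable_rV (f : 'rV[R]_n -> R) : continuous f ->
  measurable_fun setT f.
Proof.
move=> /continuousP cf; apply: (measurability _ (RGenOpens.measurableE R)).
move=> _ [_ [a [b ->] <-]]; rewrite setTI; apply: open_measurable_rV.
by apply: cf; exact: interval_open.
Qed.

Lemma cube_measure (x : 'rV[R]_n) (r : R) : 0 <= r ->
  lebesgue_rV n [set y : 'rV[R]_n | forall i, `|x ord0 i - y ord0 i| <= r] =
  ((2 * r) ^+ n)%:E.
Proof.
move=> r0.
rewrite (_ : [set y | _] = [set y : 'rV[R]_n |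
   forall i, `[x ord0 i - r, x ord0 i + r]%classic (y ord0 i)]); last first.
  by apply/seteqP; split => y /= + i => /(_ i);
    rewrite in_itv /= distrC ler_distl.
rewrite (@lebesgue_rV_box _ _ (fun i => `[x ord0 i - r, x ord0 i +
  r]%classic))//.
rewrite (eq_bigr (fun=> (2 * r)%:E)).
  by rewrite prodEFin prodr_const card_ord.
move=> i _; rewrite lebesgue_measure_itv /= lte_fin.
case: ltP => h; rewrite -?EFinB; congr EFin; lra.
Qed.

Lemma measurable_cube (x : 'rV[R]_n) (r : R) :
  measurable [set y : 'rV[R]_n | forall i, `|x ord0 i - y ord0 i| <= r].
Proof.
rewrite (_ : [set y | _] = [set y : 'rV[R]_n |
   forall i, `[x ord0 i - r, x ord0 i + r]%classic (y ord0 i)]).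
  by apply: (@measurable_box (fun i => `[x ord0 i - r, x ord0 i + r]%classic)).
by apply/seteqP; split => y /= + i => /(_ i);
  rewrite in_itv /= distrC ler_distl.
Qed.

Lemma bounded_set_cube (A : set 'rV[R]_n) : bounded_set A ->
  exists2 M : R, 0 < M &
    A `<=` [set y : 'rV[R]_n | forall i, `|y ord0 i| <= M].
Proof.
move=> [M [_ /(_ (Num.max 1 (M + 1)))]].
rewrite lt_max ltrDl ltr01 orbT => /(_ isT) AM.
exists (Num.max 1 (M + 1)); first by rewrite lt_max ltr01.
move=> y /AM /= yM i; apply: le_trans yM.
by rewrite [leRHS]/Num.norm /= mx_normrE; apply/bigmax_geP; right => /=;
  exists (ord0, i).
Qed.

Lemma bounded_measure (A : set 'rV[R]_n) : bounded_set A -> measurable A ->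
  (lebesgue_rV n A < +oo)%E.
Proof.
move=> /bounded_set_cube[M M0 AM] mA.
apply: (@le_lt_trans _ _ ((2 * M) ^+ n)%:E); last exact: ltry.
rewrite -(cube_measure (0 : 'rV[R]_n) (ltW M0)).
apply: le_measure; rewrite ?inE//; first exact: measurable_cube.
by move=> y /AM /= yM i; rewrite mxE sub0r normrN.
Qed.

End borel_rV.

(** * Integration tools and weighted scalar products *)

Section integration.
Context d (T : measurableType d) (R : realType).
Variable mu : {measure set T -> \bar R}.
Implicit Types f g : T -> R.

Lemma le_int_real f g : measurable_fun setT f -> measurable_fun setT g ->
  (forall x, 0 <= f x) -> (forall x, f x <= g x) ->
  (\int[mu]_x (f x)%:E <= \int[mu]_x (g x)%:E)%E.
Proof.
move=> mf mg f0 fg; apply: ge0_le_integral => //.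
- by move=> x _; rewrite lee_fin.
- exact/measurable_EFinP.
- exact/measurable_EFinP.
- by move=> x _; rewrite lee_fin.
Qed.

Lemma int_real_lty f : measurable_fun setT f -> (forall x, 0 <= f x) ->
  (\int[mu]_x (f x)%:E < +oo)%E -> mu.-integrable setT (EFin \o f).
Proof.
move=> mf f0 fy; apply/integrableP; split; first exact/measurable_EFinP.
by under eq_integral => x _ do rewrite /= ger0_norm//.
Qed.

Lemma Rintegral_EFin f : mu.-integrable setT (EFin \o f) ->
  (\int[mu]_x (f x)%:E)%E = (\int[mu]_x f x)%:E.
Proof. by move=> fi; rewrite /Rintegral fineK//; exact: integrable_fin_num. Qed.

Lemma ge0_int0_ae f : measurable_fun setT f -> (forall x, 0 <= f x) ->
  (\int[mu]_x (f x)%:E = 0)%E -> {ae mu, forall x, f x = 0}.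
Proof.
move=> mf f0 if0.
have mF : measurable_fun setT (EFin \o f) by exact/measurable_EFinP.
have : (\int[mu]_x `|(EFin \o f) x| = 0)%E.
  by rewrite -if0; apply: eq_integral => x _; rewrite gee0_abs// lee_fin.
move/(ae_eq_integral_abs mu measurableT mF); apply: filterS => x /(_ I) /eqP.
by rewrite eqe => /eqP.
Qed.

(** Fatou's lemma in the form used throughout: integral bounds pass to almost
    everywhere limits. *)
Lemma fatou_ae (f : nat -> T -> R) g (B : \bar R) :
  (forall n, measurable_fun setT (f n)) -> measurable_fun setT g ->
  (forall n x, 0 <= f n x) -> (forall x, 0 <= g x) ->
  {ae mu, forall x, f ^~ x @ \oo --> g x} ->
  (forall n, (\int[mu]_x (f n x)%:E <= B)%E) ->
  (\int[mu]_x (g x)%:E <= B)%E.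
Proof.
move=> mf mg f0 g0 fg fB.
have mF n : measurable_fun setT (EFin \o f n) by exact/measurable_EFinP.
apply: (@le_trans _ _ (\int[mu]_x limn_einf (fun n => (f n x)%:E))%E).
  apply: ae_ge0_le_integral => //.
  - by move=> x _; rewrite lee_fin.
  - exact/measurable_EFinP.
  - move=> x _; rewrite limn_einf_lim; apply: lime_ge;
    first exact: is_cvg_einfs.
    apply: nearW => n; apply: le_ereal_inf_tmp => _ [m _ <-].
    by rewrite lee_fin.
  - rewrite (_ : (fun x => _) = (fun x => - limn_esup (fun n => - (f n
    x)%:E))%E).
      apply: measurableT_comp => //; apply: measurable_fun_limn_esup => n.
      by apply: measurableT_comp => //; exact: mF.
    apply/funext => x; rewrite -(limn_einfN (fun n => - (f n x)%:E)%E).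
    by congr limn_einf; apply/funext => n /=; rewrite opprK.
  - apply: filterS fg => x fgx _.
    have fgE : (f n x)%:E @[n --> \oo] --> (g x)%:E.
      by apply: cvg_comp fgx _; exact: cvg_id.
    by have [-> _] := cvg_limn_einf_sup fgE.
apply: (le_trans (@fatou _ _ _ mu setT measurableT (fun n x => (f n x)%:E) mF
  _)).
  by move=> n x _; rewrite lee_fin.
rewrite limn_einf_lim; apply: lime_le; first exact: is_cvg_einfs.
apply: nearW => n; apply: le_trans (fB n).
by apply: ereal_inf_lbound; exists n => /=.
Qed.

(** Choose the subsequence so that the integrals are summable. *)
Lemma cvg_int0_subseq_ae (g : nat -> T -> R) :
  (forall n, measurable_fun setT (g n)) -> (forall n x, 0 <= g n x) ->
  (fun n => \int[mu]_x (g n x)%:E)%E @ \oo --> 0%E ->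
  exists sigma : nat -> nat, (forall k, (k <= sigma k)%N) /\
    {ae mu, forall x, g (sigma k) x @[k --> \oo] --> (0 : R)}.
Proof.
move=> mg g0 gcvg.
have /choice[sigma sP] : forall k, exists m, (k <= m)%N /\
    (\int[mu]_x (g m x)%:E <= (1 / (2 ^ k.+1)%:R)%:E)%E.
  move=> k; have e0 : 0 < 1 / (2 ^ k.+1)%:R :> R.
    by rewrite divr_gt0// ltr0n expn_gt0.
  have : (\forall n \near \oo,
      \int[mu]_x (g n x)%:E < (1 / (2 ^ k.+1)%:R)%:E)%E.
    apply: (gcvg [set y | y < (1 / (2 ^ k.+1)%:R)%:E]%E).
    by apply: open_ereal_lt'; rewrite lte_fin.
  move=> [m _ mP]; exists (maxn k m); split; first exact: leq_maxl.
  by apply: ltW; apply: mP; exact: leq_maxr.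
exists sigma; split; first by move=> k; have [] := sP k.
pose h k x := (g (sigma k) x)%:E.
have mh k : measurable_fun setT (h k) by exact/measurable_EFinP.
have h0 k x : (0 <= h k x)%E by rewrite lee_fin.
have Sfin : (\int[mu]_x (\sum_(k <oo) h k x) < +oo)%E.
  rewrite integral_nneseries//.
  apply: (@le_lt_trans _ _ 1%E); last exact: ltry.
  apply: le_trans (epsilon_trick0 xpredT (@ler01 R)).
  apply: lee_nneseries => [k _ _|k _]; first by apply: integral_ge0 => x _;
    exact: h0.
  by have [] := sP k.
have Sint : mu.-integrable setT (fun x => \sum_(k <oo) h k x)%E.
  apply/integrableP; split.
    by apply: (@ge0_emeasurable_sum _ _ _ setT h xpredT).
  rewrite (eq_integral (fun x => \sum_(k <oo) h k x)%E)// => x _.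
  by rewrite gee0_abs//; apply: nneseries_ge0 => k _ _; exact: h0.
apply: filterS (integrable_ae measurableT Sint) => x /(_ I) Sx.
apply: cvg_series_cvg_0; apply: nondecreasing_is_cvgn.
  by apply: nondecreasing_series => k _ _.
exists (fine (\sum_(k <oo) h k x)%E) => _ [k _ <-].
rewrite -lee_fin fineK// /series /= -sumEFin.
by apply: nneseries_lim_ge => i _ _; exact: h0.
Qed.

End integration.

Section weighted_square.
Context d (T : measurableType d) (R : realType).
Variables (mu : {measure set T -> \bar R}) (k : T -> R).
Hypotheses (mk : measurable_fun setT k) (k0 : forall z, 0 <= k z).
Implicit Types a b c : T -> R.

(** Square integrable functions for the weighted measure [k mu], and their
    scalar product.  Keeping the weight out of the measure matches the way the
    Gagliardo energies are written. *)
Definition wL2 a := measurable_fun setT a /\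
  (\int[mu]_z (a z ^+ 2 * k z)%:E < +oo)%E.

Definition wdot a b : R := \int[mu]_z (a z * b z * k z).

Lemma measurable_wdot a b : measurable_fun setT a -> measurable_fun setT b ->
  measurable_fun setT (fun z => a z * b z * k z).
Proof. by move=> ma mb; apply: measurable_funM => //;
  exact: measurable_funM. Qed.

Lemma measurable_wsq a : measurable_fun setT a ->
  measurable_fun setT (fun z => a z ^+ 2 * k z).
Proof. by move=> ma; exact: (measurable_wdot ma ma). Qed.

Lemma wsq_ge0 a z : 0 <= a z ^+ 2 * k z.
Proof. by rewrite mulr_ge0// sqr_ge0. Qed.

Lemma wL2_le a b c : measurable_fun setT c -> wL2 a -> wL2 b ->
  (forall z, c z ^+ 2 <= a z ^+ 2 + b z ^+ 2) -> wL2 c.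
Proof.
move=> mc [ma ia] [mb ib] cab; split => //.
apply: (@le_lt_trans _ _ (\int[mu]_z ((a z ^+ 2 * k z) + (b z ^+ 2 * k
  z))%:E)%E).
  apply: le_int_real.
  - exact: measurable_wsq.
  - by apply: measurable_funD; exact: measurable_wsq.
  - exact: wsq_ge0.
  - by move=> z; rewrite -mulrDl ler_wpM2r.
under eq_integral do rewrite EFinD.
rewrite ge0_integralD//.
- by rewrite lte_add_pinfty.
- by move=> z _; rewrite lee_fin wsq_ge0.
- by apply/measurable_EFinP; exact: measurable_wsq.
- by move=> z _; rewrite lee_fin wsq_ge0.
- by apply/measurable_EFinP; exact: measurable_wsq.
Qed.

Lemma wL2Z r a : wL2 a -> wL2 (fun z => r * a z).
Proof.
move=> [ma ia]; split; first exact: measurable_funM.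
under eq_integral do rewrite exprMn -mulrA EFinM.
rewrite ge0_integralZl//.
- by rewrite lte_mul_pinfty// lee_fin sqr_ge0.
- by apply/measurable_EFinP; exact: measurable_wsq.
- by move=> z _; rewrite lee_fin wsq_ge0.
- by rewrite lee_fin sqr_ge0.
Qed.

Lemma wL2D a b : wL2 a -> wL2 b -> wL2 (fun z => a z + b z).
Proof.
move=> wa wb; apply: (wL2_le _ (wL2Z 2 wa) (wL2Z 2 wb)).
  by apply: measurable_funD; [case: wa|case: wb].
move=> z; have := sqr_ge0 (a z - b z).
have := sqr_ge0 (a z); have := sqr_ge0 (b z); nra.
Qed.

Lemma wL2_integrable a b : wL2 a -> wL2 b ->
  mu.-integrable setT (EFin \o (fun z => a z * b z * k z)).
Proof.
move=> wa wb; have [[ma ia] [mb ib]] := (wa, wb).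
have i1 := int_real_lty (measurable_wsq ma) (wsq_ge0 a) ia.
have i2 := int_real_lty (measurable_wsq mb) (wsq_ge0 b) ib.
apply: le_integrable (integrableD measurableT i1 i2) => //.
  by apply/measurable_EFinP; exact: measurable_wdot.
move=> z _ /=; rewrite lee_fin.
rewrite -mulrDl normrM (ger0_norm (k0 z)) [leRHS]ger0_norm; last first.
  by rewrite mulr_ge0// addr_ge0// sqr_ge0.
apply: ler_wpM2r => //; rewrite normrM.
rewrite -(real_normK (num_real (a z))) -(real_normK (num_real (b z))).
have := sqr_ge0 (`|a z| - `|b z|).
have := sqr_ge0 `|a z|; have := sqr_ge0 `|b z|; nra.
Qed.

Lemma wdotE a b : wL2 a -> wL2 b ->
  (\int[mu]_z (a z * b z * k z)%:E)%E = (wdot a b)%:E.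
Proof.
move=> wa wb; rewrite /wdot /Rintegral fineK//.
exact/integrable_fin_num/wL2_integrable.
Qed.

Lemma wdotC a b : wdot a b = wdot b a.
Proof. by apply: eq_Rintegral => z _; rewrite (mulrC (a z)). Qed.

Lemma wdotDl a b c : wL2 a -> wL2 b -> wL2 c ->
  wdot (fun z => a z + b z) c = wdot a c + wdot b c.
Proof.
move=> wa wb wc; rewrite /wdot -RintegralD//; [|exact: wL2_integrable..].
by apply: eq_Rintegral => z _; rewrite !mulrDl.
Qed.

Lemma wdotZl r a c : wL2 a -> wL2 c ->
  wdot (fun z => r * a z) c = r * wdot a c.
Proof.
move=> wa wc; rewrite /wdot -RintegralZl//; last exact: wL2_integrable.
by apply: eq_Rintegral => z _; rewrite !mulrA.
Qed.

Lemma wdot_ge0 a b : (forall z, 0 <= a z * b z) -> 0 <= wdot a b.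
Proof. by move=> ab0; apply: Rintegral_ge0 => z _; rewrite mulr_ge0. Qed.

Lemma wdot_young a b : wL2 a -> wL2 b -> 2 * wdot a b <= wdot a a + wdot b b.
Proof.
move=> wa wb; have wN := wL2Z (-1) wb.
have ww := wL2D wa wN.
have : 0 <= wdot (fun z => a z + -1 * b z) (fun z => a z + -1 * b z).
  by apply: wdot_ge0 => z; rewrite -expr2 sqr_ge0.
rewrite wdotDl// wdotZl// (wdotC a) (wdotC b) !wdotDl// !wdotZl//.
rewrite (wdotC b a); lra.
Qed.

End weighted_square.

(** * Powers, the Gagliardo energy and its lower semicontinuity *)

Section powers.
Context {R : realType} (q : R).
Hypothesis q1 : 1 < q.
Let q0 : 0 < q := lt_trans ltr01 q1.

(** Convexity of [x ^ q] through its tangent at [b]; an instance of Young's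
    inequality for the conjugate exponents [q] and [q / (q - 1)]. *)
Lemma powR_tangent (a b : R) : 0 <= a -> 0 <= b ->
  b `^ q + q * (b `^ (q - 1) * (a - b)) <= a `^ q.
Proof.
move=> a0 b0.
have qm0 : 0 < q - 1 by rewrite subr_gt0.
have qq : 0 < q / (q - 1) by rewrite divr_gt0.
have e1 : q^-1 + (q / (q - 1))^-1 = 1 by field; apply/andP; split; lra.
have := conjugate_powR a0 (powR_ge0 b (q - 1)) q0 qq e1.
rewrite -powRrM (_ : (q - 1) * (q / (q - 1)) = q); last by field; lra.
rewrite mulrBr (_ : b `^ (q - 1) * b = b `^ q); last first.
  by rewrite mulrC mulr_powRB1.
rewrite invf_div; move: (b `^ q) (b `^ (q - 1)) (a `^ q) => x y z h.
have : q * (a * y) <= q * (z / q + x * ((q - 1) / q)) by rewrite ler_wpM2l//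
  ltW.
rewrite (_ : q * (z / q + x * ((q - 1) / q)) = z + x * (q - 1)); last first.
  by field; rewrite gt_eqF.
lra.
Qed.

Lemma powR_midpoint (a b : R) : 0 <= a -> 0 <= b ->
  ((a + b) / 2) `^ q <= (a `^ q + b `^ q) / 2.
Proof.
move=> a0 b0; have m0 : 0 <= (a + b) / 2 by lra.
have := powR_tangent a0 m0; have := powR_tangent b0 m0.
rewrite (_ : a - (a + b) / 2 = (a - b) / 2); last by lra.
rewrite (_ : b - (a + b) / 2 = - ((a - b) / 2)); last by lra.
rewrite !mulrN; set x := _ `^ q; set t := q * _; set y := b `^ q;
  set z := a `^ q.
move: x t y z => x t y z; lra.
Qed.

Lemma ler_powR_q (a b : R) : 0 <= a -> a <= b -> a `^ q <= b `^ q.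
Proof.
by move=> a0 ab; rewrite ge0_ler_powR ?nnegrE ?(ltW q0)//; exact: le_trans ab.
Qed.

Lemma powR_norm_add (a b : R) :
  `|a + b| `^ q <= 2 `^ q * (`|a| `^ q + `|b| `^ q).
Proof.
apply: (@le_trans _ _ ((2 * Num.max `|a| `|b|) `^ q)).
  apply: ler_powR_q => //; apply: le_trans (ler_normD _ _) _.
  rewrite mulr_natl mulr2n lerD// le_max lexx// orbT//.
rewrite powRM// ?le_max ?normr_ge0//.
rewrite ler_wpM2l// ?powR_ge0//.
have := powR_ge0 `|a| q; have := powR_ge0 `|b| q.
by rewrite /Num.max; case: ifP => _; lra.
Qed.

End powers.

Section gagliardo.
Context {R : realType} {N : nat}.
Variables (s q : R) (Omega : set 'rV[R]_N).
Hypotheses (q1 : 1 < q) (oOmega : open Omega).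
Hypothesis bOmega : bounded_set Omega.
Let q0 : 0 < q := lt_trans ltr01 q1.
Local Notation V := ('rV[R]_N).
Local Notation leb := (@lebesgue_rV R N).
Implicit Types u v w f g h : V -> R.

(** If [N + 2 s] is positive, then the kernel is 0 on the diagonal, since 0 to
    a positive power is 0 and so is its inverse. *)
Definition riesz (z : V * V) : R :=
  (euclidean_norm (z.1 - z.2) `^ (N%:R + 2 * s))^-1.

Definition increment u (z : V * V) : R := u z.1 - u z.2.

Lemma gagliardo_sqE u : gagliardo_sq s u =
  (\int[leb \x leb]_z (increment u z ^+ 2 * riesz z)%:E)%E.
Proof. by []. Qed.

Lemma riesz_ge0 z : 0 <= riesz z.
Proof. by rewrite invr_ge0 powR_ge0. Qed.

Lemma measurable_euclidean :
  measurable_fun setT (fun z : V * V => euclidean_norm (z.1 - z.2)).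
Proof.
rewrite (_ : (fun _ => _) = (fun z : V * V =>
  (\sum_(i < N) (z.1 ord0 i - z.2 ord0 i) ^+ 2) `^ 2^-1)).
  apply: (measurableT_comp (measurable_powR _)).
  apply: measurable_sum => i; apply: measurable_funX.
  apply: measurable_funB.
    exact: (measurableT_comp (measurable_coord i) measurable_fst).
  exact: (measurableT_comp (measurable_coord i) measurable_snd).
apply/funext => z; rewrite powR12_sqrt; last first.
  by apply: sumr_ge0 => i _; exact: sqr_ge0.
by rewrite /euclidean_norm; under eq_bigr do rewrite !mxE.
Qed.

Lemma measurable_riesz : measurable_fun setT riesz.
Proof.
rewrite (_ : riesz = (fun z : V * V =>
  euclidean_norm (z.1 - z.2) `^ (- (N%:R + 2 * s)))).
  exact: (measurableT_comp (measurable_powR _) measurable_euclidean).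
by apply/funext => z; rewrite powRN.
Qed.

Lemma measurable_increment u : measurable_fun setT u ->
  measurable_fun setT (increment u).
Proof.
move=> mu; apply: measurable_funB.
  exact: (measurableT_comp mu measurable_fst).
exact: (measurableT_comp mu measurable_snd).
Qed.

Lemma measurable_Omega : measurable Omega.
Proof. exact: open_measurable_rV. Qed.
Local Hint Resolve measurable_Omega measurable_riesz riesz_ge0 : core.

Lemma test_function_measurable f : test_function Omega f ->
  measurable_fun setT f.
Proof.
by move=> /test_function_smooth/smooth_continuous;
  exact: continuous_measurable_rV.
Qed.

Lemma ae_product (P : V -> Prop) : {ae leb, forall x, P x} ->
  {ae (leb \x leb)%E, forall z : V * V, P z.1 /\ P z.2}.
Proof.
move=> [A [mA A0 PA]].
exists ((A `*` setT) `|` (setT `*` A)); split.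
- by apply: measurableU; exact: measurableX.
- apply/eqP; rewrite eq_le measure_ge0 andbT.
  apply: le_trans (measureU2 _ _ _) _; try exact: measurableX.
  have e1 : (leb \x leb)%E (A `*` setT) = 0%E.
    by rewrite product_measure1E// [X in (X * _)%E]A0 mul0e.
  have e2 : (leb \x leb)%E (setT `*` A) = 0%E.
    by rewrite product_measure1E// [X in (_ * X)%E]A0 mule0.
  by rewrite -[leRHS]adde0; apply: leeD; rewrite le_eqVlt; apply/orP; left;
    apply/eqP; [exact: e1|exact: e2].
- move=> z /= /not_andP[nP|nP]; [left|right].
    by split => //; apply: PA.
  by split => //; apply: PA.
Qed.

Lemma integral_Omega (F : V -> R) : (forall x, ~ Omega x -> F x = 0) ->
  (\int[leb]_(x in Omega) (F x)%:E = \int[leb]_x (F x)%:E)%E.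
Proof.
move=> F0; rewrite integral_mkcond; apply: eq_integral => x _.
by rewrite patchE; case: ifPn => //; rewrite notin_setE => /F0 ->.
Qed.

Definition dist_q f h : \bar R := (\int[leb]_x (`|f x - h x| `^ q)%:E)%E.

Lemma dist_qE f h : (forall x, ~ Omega x -> f x = 0) ->
  (forall x, ~ Omega x -> h x = 0) ->
  (\int[leb]_(x in Omega) (`|f x - h x| `^ q)%:E)%E = dist_q f h.
Proof.
move=> f0 h0; rewrite (integral_Omega (F := fun x => `|f x - h x| `^ q))//.
by move=> x nx; rewrite f0// h0// subrr normr0 powR0// gt_eqF.
Qed.

Lemma dist_q_ge0 f h : (0 <= dist_q f h)%E.
Proof. by apply: integral_ge0 => x _; rewrite lee_fin powR_ge0. Qed.

Lemma measurable_powR_norm f : measurable_fun setT f ->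
  measurable_fun setT (fun x => `|f x| `^ q).
Proof.
move=> mf; apply: (measurableT_comp (measurable_powR _)).
exact: measurableT_comp.
Qed.

Lemma dist_q_subseq_ae (f : nat -> V -> R) h :
  (forall n, measurable_fun setT (f n)) -> measurable_fun setT h ->
  (fun n => dist_q (f n) h) @ \oo --> 0%E ->
  exists sigma : nat -> nat, (forall k, (k <= sigma k)%N) /\
    {ae leb, forall x, f (sigma k) x @[k --> \oo] --> h x}.
Proof.
move=> mf mh fh.
have [||sigma [sk sae]] := @cvg_int0_subseq_ae _ _ _ leb
    (fun n x => `|f n x - h x| `^ q) _ _ fh.
- by move=> n; apply: measurable_powR_norm; exact: measurable_funB.
- by move=> n x; exact: powR_ge0.
exists sigma; split => //; apply: filterS sae => x fx.
apply/cvgrPdist_lt => e e0.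
have eq0 : 0 < e `^ q by exact: powR_gt0.
have /cvgr0Pnorm_lt/(_ _ eq0) := fx.
apply: filterS => k; rewrite ger0_norm ?powR_ge0// distrC.
rewrite ltNge => /negP hk; rewrite ltNge; apply/negP => ek; apply: hk.
by apply: ler_powR_q => //; exact: ltW.
Qed.

(** L^q convergence gives almost everywhere convergence of a subsequence, hence
    of the increments, and Fatou's lemma applies. *)
Lemma gagliardo_lsc (f : nat -> V -> R) h (B : \bar R) :
  (forall n, measurable_fun setT (f n)) -> measurable_fun setT h ->
  (fun n => dist_q (f n) h) @ \oo --> 0%E ->
  (\forall n \near \oo, (gagliardo_sq s (f n) <= B)%E) ->
  (gagliardo_sq s h <= B)%E.
Proof.
move=> mf mh fh [n0 _ fB].
have fh' : (fun n => dist_q (f (n + n0)%N) h) @ \oo --> 0%E.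
  by rewrite (cvg_shiftn n0 (fun n => dist_q (f n) h) _).
have [sigma [sk sae]] := dist_q_subseq_ae (fun n => mf (n + n0)%N) mh fh'.
have mi v : measurable_fun setT v ->
    measurable_fun setT (fun z => increment v z ^+ 2 * riesz z).
  by move=> mv; apply: measurable_wsq => //; exact: measurable_increment.
apply: (@fatou_ae _ _ _ _
  (fun k z => increment (f (sigma k + n0)%N) z ^+ 2 * riesz z)
  (fun z => increment h z ^+ 2 * riesz z)).
- by move=> k; exact: mi.
- exact: mi.
- by move=> k z; exact: wsq_ge0.
- by move=> z; exact: wsq_ge0.
- apply: filterS (ae_product sae) => z [c1 c2].
  have c : increment (f (sigma k + n0)%N) z @[k --> \oo] --> increment h z.
    exact: (cvgB c1 c2).
  exact: (cvgM (cvgM c c) (cvg_cst (riesz z))).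
- by move=> k; apply: fB => /=; rewrite leq_addl.
Qed.

End gagliardo.

(** * The energy space through bounded approximation *)

Section energy_space.
Context {R : realType} {N : nat}.
Variables (s q : R) (Omega : set 'rV[R]_N).
Hypothesis q1 : 1 < q.
Let q0 : 0 < q := lt_trans ltr01 q1.
Local Notation V := ('rV[R]_N).
Local Notation leb := (@lebesgue_rV R N).
Implicit Types u v w f g h : V -> R.
Local Notation gsq := (gagliardo_sq s).
Local Notation dq := (dist_q q).
Let mr := @measurable_riesz R N s.
Let r0 := @riesz_ge0 R N s.

Definition finite_energy u :=
  wL2 (leb \x leb)%E (riesz s) (increment u).

Definition dotG u v : R :=
  wdot (leb \x leb)%E (riesz s) (increment u) (increment v).

Lemma finite_energyP u : measurable_fun setT u -> (gsq u < +oo)%E ->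
  finite_energy u.
Proof. by move=> mu fu; split => //; exact: measurable_increment. Qed.

Lemma gagliardo_sq_ge0 u : (0 <= gsq u)%E.
Proof.
by apply: integral_ge0 => z _; rewrite lee_fin;
  exact: (wsq_ge0 r0 (increment u)).
Qed.

Lemma dotGE u : finite_energy u -> gsq u = (dotG u u)%:E.
Proof. by move=> fu; rewrite /dotG -(wdotE mr r0 fu fu). Qed.

Lemma gagliardo_form_dotG u v : finite_energy u -> finite_energy v ->
  gagliardo_form s u v = (dotG u v)%:E.
Proof. by move=> fu fv; rewrite /dotG -(wdotE mr r0 fu fv). Qed.

Lemma increment_add u v :
  increment (u \+ v) = (fun z : V * V => increment u z + increment v z).
Proof. by apply/funext => z; rewrite /increment /=; ring. Qed.

Lemma increment_scale c u :
  increment (c \*o u) = (fun z : V * V => c * increment u z).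
Proof. by apply/funext => z; rewrite /increment /=; ring. Qed.

Lemma increment_sub u v : increment (u \- v) = increment (u \+ (-1 \*o v)).
Proof. by apply/funext => z; rewrite /increment /=; ring. Qed.

Lemma finite_energyD u v : finite_energy u -> finite_energy v ->
  finite_energy (u \+ v).
Proof. by rewrite /finite_energy increment_add; exact: wL2D. Qed.

Lemma finite_energyZ c u : finite_energy u -> finite_energy (c \*o u).
Proof. by rewrite /finite_energy increment_scale; exact: wL2Z. Qed.

Lemma finite_energyB u v : finite_energy u -> finite_energy v ->
  finite_energy (u \- v).
Proof.
move=> fu fv; rewrite /finite_energy increment_sub.
exact: finite_energyD fu (finite_energyZ (-1) fv).
Qed.

Lemma dotGC u v : dotG u v = dotG v u.
Proof. exact: wdotC. Qed.

Lemma dotGDl u v w : finite_energy u -> finite_energy v -> finite_energy w ->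
  dotG (u \+ v) w = dotG u w + dotG v w.
Proof. by move=> fu fv fw; rewrite /dotG increment_add wdotDl. Qed.

Lemma dotGDr u v w : finite_energy u -> finite_energy v -> finite_energy w ->
  dotG w (u \+ v) = dotG w u + dotG w v.
Proof. by move=> fu fv fw; rewrite dotGC dotGDl// !(dotGC w). Qed.

Lemma dotGZl c u w : finite_energy u -> finite_energy w ->
  dotG (c \*o u) w = c * dotG u w.
Proof. by move=> fu fw; rewrite /dotG increment_scale wdotZl. Qed.

Lemma dotGZr c u w : finite_energy u -> finite_energy w ->
  dotG w (c \*o u) = c * dotG w u.
Proof. by move=> fu fw; rewrite dotGC dotGZl// (dotGC w). Qed.

Lemma dotGBl u v w : finite_energy u -> finite_energy v -> finite_energy w ->
  dotG (u \- v) w = dotG u w - dotG v w.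
Proof.
move=> fu fv fw.
have -> : dotG (u \- v) w = dotG (u \+ (-1 \*o v)) w.
  by rewrite /dotG increment_sub.
by rewrite dotGDl ?dotGZl ?mulN1r//; exact: finite_energyZ.
Qed.

Lemma dotG_ge0 u : 0 <= dotG u u.
Proof. by apply: wdot_ge0 => z; rewrite // -expr2 sqr_ge0. Qed.

Lemma dotG_young u v : finite_energy u -> finite_energy v ->
  2 * dotG u v <= dotG u u + dotG v v.
Proof. by move=> fu fv; exact: wdot_young. Qed.

Lemma dotG_subE u v : finite_energy u -> finite_energy v ->
  dotG (u \- v) (u \- v) = dotG u u + dotG v v - 2 * dotG u v.
Proof.
move=> fu fv.
have -> : dotG (u \- v) (u \- v) = dotG (u \+ (-1 \*o v)) (u \+ (-1 \*o v)).
  by rewrite /dotG increment_sub.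
have fZ := finite_energyZ (-1) fv.
rewrite dotGDl//; last exact: finite_energyD.
rewrite !dotGDr// !dotGZl// !dotGZr// (dotGC v u); ring.
Qed.

Lemma dotG_parallelogram u v : finite_energy u -> finite_energy v ->
  dotG (u \- v) (u \- v) =
  2 * dotG u u + 2 * dotG v v -
    4 * dotG (2^-1 \*o (u \+ v)) (2^-1 \*o (u \+ v)).
Proof.
move=> fu fv; have fD := finite_energyD fu fv.
rewrite dotG_subE// dotGZl//; last exact: finite_energyZ.
rewrite dotGZr// dotGDl// !dotGDr// (dotGC v u).
by field.
Qed.

Lemma gagliardo_sq_add u v : measurable_fun setT u -> measurable_fun setT v ->
  (gsq (u \+ v)%R <= 2%:E * gsq u + 2%:E * gsq v)%E.
Proof.
move=> mu mv.
have mI w : measurable_fun setT w ->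
    measurable_fun setT (fun z => (increment w z ^+ 2 * riesz s z)%:E).
  move=> mw; apply/measurable_EFinP.
  by apply: measurable_wsq => //; exact: measurable_increment.
rewrite !gagliardo_sqE -!ge0_integralZl//; last 4 first.
- exact: mI.
- by move=> z _; rewrite lee_fin wsq_ge0.
- exact: mI.
- by move=> z _; rewrite lee_fin wsq_ge0.
rewrite -ge0_integralD//; last 4 first.
- by move=> z _; rewrite -EFinM lee_fin mulr_ge0// wsq_ge0.
- by apply: measurable_funeM; exact: mI.
- by move=> z _; rewrite -EFinM lee_fin mulr_ge0// wsq_ge0.
- by apply: measurable_funeM; exact: mI.
apply: ge0_le_integral => //.
- by move=> z _; rewrite lee_fin wsq_ge0.
- by apply: mI; exact: measurable_funD.
- by apply: emeasurable_funD; apply: measurable_funeM; exact: mI.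
move=> z _; rewrite -!EFinM -EFinD lee_fin increment_add !mulrA -mulrDl.
apply: ler_wpM2r => //.
have := sqr_ge0 (increment u z - increment v z).
move: (increment u z) (increment v z) => a b; nra.
Qed.

Lemma dist_q_midpoint f g h :
  measurable_fun setT f -> measurable_fun setT g -> measurable_fun setT h ->
  forall e : R, (dq f h <= e%:E)%E -> (dq g h <= e%:E)%E ->
  (dq (2^-1 \*o (f \+ g))%R h <= e%:E)%E.
Proof.
move=> mf mg mh e fe ge.
have mI w : measurable_fun setT w ->
    measurable_fun setT (fun x => `|w x - h x| `^ q).
  by move=> mw; apply: measurable_powR_norm; exact: measurable_funB.
apply: (@le_trans _ _ (2^-1%:E * (dq f h + dq g h))%E); last first.
  apply: (@le_trans _ _ (2^-1%:E * (e%:E + e%:E))%E).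
    by apply: lee_wpmul2l; [rewrite lee_fin|exact: (leeD fe ge)].
  by rewrite -EFinD -EFinM lee_fin; lra.
rewrite /dist_q -ge0_integralD//; last 2 first.
- by apply/measurable_EFinP; exact: mI.
- by apply/measurable_EFinP; exact: mI.
have mS : measurable_fun setT
    (fun x => ((`|f x - h x| `^ q)%:E + (`|g x - h x| `^ q)%:E)%E).
  by apply: emeasurable_funD; apply/measurable_EFinP; exact: mI.
rewrite -ge0_integralZl//; last first.
  by move=> x _; rewrite -EFinD lee_fin addr_ge0// powR_ge0.
apply: ge0_le_integral => //.
- apply/measurable_EFinP; apply: mI.
  by apply: measurable_funM => //; exact: measurable_funD.
- exact: measurable_funeM.
move=> x _; rewrite -EFinD -EFinM lee_fin /= [leRHS]mulrC.
apply: le_trans (powR_midpoint q1 (normr_ge0 _) (normr_ge0 _)).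
apply: ler_powR_q => //.
rewrite (_ : _ - h x = ((f x - h x) + (g x - h x)) / 2); last by field.
by rewrite normrM (ger0_norm (_ : 0 <= 2^-1))// ler_wpM2r// ler_normD.
Qed.

(** The energy space in a form that is easy to check: approximants of bounded
    energy, with no Cauchy condition. *)
Definition approximable h := [/\ measurable_fun setT h,
  (forall x, ~ Omega x -> h x = 0) &
  exists C : R, forall e : R, 0 < e -> exists f,
    [/\ test_function Omega f, (gsq f <= C%:E)%E & (dq f h <= e%:E)%E]].

Lemma cvge_squeeze0 (a : nat -> \bar R) :
  (forall n, 0 <= a n)%E -> (forall n, a n <= n.+1%:R^-1%:E)%E ->
  a @ \oo --> 0%E.
Proof.
move=> a0 a1; apply: (@squeeze_cvge _ _ _ _ (cst 0%E) _ (fun n =>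
  n.+1%:R^-1%:E)).
- by apply: nearW => n; rewrite a0 a1.
- exact: cvg_cst.
- by apply/cvg_EFin; [exact: nearW|exact: cvg_harmonic].
Qed.

Lemma approximable_seq h : approximable h -> exists (C : R) (f : nat -> V -> R),
  [/\ forall n, test_function Omega (f n), forall n, (gsq (f n) <= C%:E)%E,
    forall n, (dq (f n) h <= n.+1%:R^-1%:E)%E &
    (fun n => dq (f n) h) @ \oo --> 0%E].
Proof.
move=> [mh h0 [C hC]]; exists C.
have /choice[f fP] : forall n : nat, exists f, [/\ test_function Omega f,
    (gsq f <= C%:E)%E & (dq f h <= n.+1%:R^-1%:E)%E].
  by move=> n; apply: hC; rewrite invr_gt0.
exists f; split=> [n|n|n|]; try by have [] := fP n.
apply: cvge_squeeze0 => n; first exact: dist_q_ge0.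
by have [] := fP n.
Qed.

Lemma approximable_finite h : approximable h -> finite_energy h.
Proof.
move=> ah; have [mh h0 _] := ah.
have [C [f [tf fC _ fh]]] := approximable_seq ah.
apply: finite_energyP => //; apply: (@le_lt_trans _ _ C%:E); last exact: ltry.
apply: (gagliardo_lsc q1 _ mh fh).
  by move=> n; exact: test_function_measurable (tf n).
exact: nearW.
Qed.

(** Among the test functions at L^q distance at most [1 / (n + 1)] from [h]
    choose [f n] of almost minimal energy.  The infima increase to a limit [L];
    midpoints of late terms are still competitors, so the parallelogram identity
    bounds the energy of [f i - f j] in terms of the distance of the infima to
    [L]. *)
Lemma approximable_D0s2 h : approximable h -> D0s2 s q Omega h.
Proof.
move=> [mh h0 [C hC]]; split=> //.
have fin_test f : test_function Omega f -> (gsq f < +oo)%E -> finite_energy f.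
  by move=> tf; apply: finite_energyP; exact: test_function_measurable tf.
pose Cn (n : nat) : set (V -> R) := [set f | [/\ test_function Omega f,
  finite_energy f & (dq f h <= n.+1%:R^-1%:E)%E]].
pose En n := [set dotG f f | f in Cn n].
have En_lb n : lbound (En n) 0 by move=> _ [f _ <-]; exact: dotG_ge0.
have EnC n : exists2 a, En n a & a <= C.
  have [|f [tf fC fh]] := hC n.+1%:R^-1; first by rewrite invr_gt0.
  have ff : finite_energy f.
    by apply: fin_test => //; exact: le_lt_trans fC (ltry _).
  by exists (dotG f f); [exists f|rewrite -lee_fin -dotGE].
have En_inf n : has_inf (En n).
  by split; [have [a ? _] := EnC n; exists a|exists 0].
pose m n := inf (En n).
have mC n : m n <= C.
  by have [a Ea aC] := EnC n; apply: le_trans aC; apply: ge_inf => //; exists 0.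
have m_nd : nondecreasing_seq m.
  move=> i j ij; apply: lb_le_inf; first by have [] := En_inf j.
  move=> _ [f [tf ff fh] <-]; apply: ge_inf; first by exists 0.
  exists f => //; split => //; apply: le_trans fh _.
  by rewrite lee_fin lef_pV2 ?posrE// ler_nat.
have m_ub : has_ubound (range m) by exists C => _ [n _ <-].
have mL : m @ \oo --> sup (range m) by exact: nondecreasing_cvgn.
have mleL n : m n <= sup (range m) by apply: ub_le_sup => //; exists n.
set L := sup (range m) in mL mleL.
have /choice[f fP] : forall n : nat, exists f,
    Cn n f /\ dotG f f < m n + n.+1%:R^-1.
  move=> n; have e0 : 0 < n.+1%:R^-1 :> R by rewrite invr_gt0.
  by have [_ [f Cf <-] fm] := inf_adherent e0 (En_inf n); exists f.
exists f; split.
- by move=> n; have [[]] := fP n.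
- move=> e e0.
  have e1 : 0 < e ^+ 2 / 16 by rewrite divr_gt0// exprn_gt0.
  (* the parallelogram identity will add up eight terms of this size *)
  have /cvgrPdist_lt/(_ _ e1) n1 := mL.
  have n2 := near_infty_natSinv_lt (PosNum e1).
  have [n0 _ n0P] : \forall n \near \oo,
      `|L - m n| < e ^+ 2 / 16 /\ n.+1%:R^-1 < e ^+ 2 / 16.
    by near=> n; split; near: n.
  have [Lm0 nV0] := n0P n0 (leqnn _).
  exists n0 => i j n0i n0j.
  have [[ti fi di] Ei] := fP i; have [[tj fj dj] Ej] := fP j.
  have inv_le k : (n0 <= k)%N -> k.+1%:R^-1 <= n0.+1%:R^-1 :> R.
    by move=> nk; rewrite lef_pV2 ?posrE// ler_nat.
  have mid : m n0 <= dotG (2^-1 \*o (f i \+ f j)) (2^-1 \*o (f i \+ f j)).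
    apply: ge_inf; first by exists 0.
    exists (2^-1 \*o (f i \+ f j)) => //; split.
    + by apply: test_function_scale; exact: test_function_add.
    + by apply: finite_energyZ; exact: finite_energyD.
    + apply: dist_q_midpoint => //; [exact: test_function_measurable ti|
        exact: test_function_measurable tj| |].
      * by apply: le_trans di _; rewrite lee_fin inv_le.
      * by apply: le_trans dj _; rewrite lee_fin inv_le.
  rewrite dotGE; last exact: finite_energyB.
  rewrite lte_fin dotG_parallelogram//.
  have := inv_le _ n0i; have := inv_le _ n0j.
  have := mleL i; have := mleL j.
  move: Lm0; rewrite ltr_norml => /andP[_ Lm0].
  have e2 : 0 < e ^+ 2 by rewrite exprn_gt0.
  move: e2 Ei Ej mid nV0 Lm0; move: (dotG _ _) (dotG _ _) (dotG _ _).
  move: (n0.+1%:R^-1) (i.+1%:R^-1) (j.+1%:R^-1) (e ^+ 2) => a b c t x y z.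
  lra.
- rewrite (_ : (fun n => _) = (fun n => dq (f n) h)); last first.
    apply/funext => n; apply: (dist_qE q1) => // x nx.
    by have [[tf _ _] _] := fP n; exact: test_function_out tf nx.
  apply: cvge_squeeze0 => n; first exact: dist_q_ge0.
  by have [[]] := fP n.
Unshelve. all: by end_near. Qed.

(** Lower semicontinuity along [f k - f n] bounds the energy of [h - f n], and
    with it the energy of [f n]. *)
Lemma D0s2_approximable h : D0s2 s q Omega h -> (gsq h < +oo)%E ->
  approximable h.
Proof.
move=> [mh h0 [f [tf fC fh]]] hoo.
have mf n : measurable_fun setT (f n) := test_function_measurable (tf n).
have {}fh : (fun n => dq (f n) h) @ \oo --> 0%E.
  move: fh; rewrite (_ : (fun n => _) = (fun n => dq (f n) h))//.
  apply/funext => n; apply: (dist_qE q1) => // x nx.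
  exact: test_function_out (tf n) nx.
have [n0 n0P] := fC 1 ltr01.
have near1 n : (n0 <= n)%N -> (gsq (h \- f n)%R <= 1%:E)%E.
  move=> n0n; apply: (@gagliardo_lsc _ _ s q q1 (fun k => f k \- f n)).
  - by move=> k; exact: measurable_funB.
  - exact: measurable_funB.
  - have -> : (fun k => dq (f k \- f n) (h \- f n)) = (fun k => dq (f k) h).
      apply/funext => k; apply: eq_integral => x _ /=.
      by congr (_ `^ q)%:E; congr `|_|; ring.
    exact: fh.
  - exists n0 => // k /= n0k.
    by have := n0P k n n0k n0n; rewrite expr1n => /ltW.
split => //; exists (2 * fine (gsq h) + 2); move=> e e0.
have [n1 _ n1P] : \forall n \near \oo, (dq (f n) h < e%:E)%E.
  apply: (fh [set y | y < e%:E]%E).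
  by apply: open_ereal_lt'; rewrite lte_fin.
exists (f (maxn n0 n1)); split => //.
- rewrite EFinD EFinM fineK; last first.
    by rewrite ge0_fin_numE// gagliardo_sq_ge0.
  have -> : f (maxn n0 n1) = h \+ (-1 \*o (h \- f (maxn n0 n1))).
    by apply/funext => x /=; ring.
  apply: le_trans (gagliardo_sq_add _ _) _ => //.
    by apply: measurable_funM => //; exact: measurable_funB.
  apply: leeD => //; rewrite -[leRHS]mule1 lee_pmul2l//.
  have -> : gsq (-1 \*o (h \- f (maxn n0 n1))) = gsq (h \- f (maxn n0 n1)).
    apply: eq_integral => z _; congr EFin; congr (_ / _) => /=; ring.
  exact/near1/leq_maxl.
- by apply/ltW/n1P/leq_maxr.
Qed.

End energy_space.

(** * Stability of the energy space *)

Section hypot.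
Context {R : realType}.
Implicit Types a b c : R.

(** The Euclidean norm of 3-space is 1-Lipschitz.  The third coordinate serves
    to smooth the modulus of the first two. *)
Lemma sqrt3_lipschitz a b c a' b' c' :
  (Num.sqrt (a ^+ 2 + b ^+ 2 + c ^+ 2) -
   Num.sqrt (a' ^+ 2 + b' ^+ 2 + c' ^+ 2)) ^+ 2 <=
  (a - a') ^+ 2 + (b - b') ^+ 2 + (c - c') ^+ 2.
Proof.
have S0 x y z : 0 <= x ^+ 2 + y ^+ 2 + z ^+ 2 :> R.
  by rewrite !addr_ge0// sqr_ge0.
rewrite sqrrB !sqr_sqrtr//.
suff : a * a' + b * b' + c * c' <= Num.sqrt (a ^+ 2 + b ^+ 2 + c ^+ 2) *
    Num.sqrt (a' ^+ 2 + b' ^+ 2 + c' ^+ 2).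
  set x := _ * Num.sqrt _; rewrite !sqrrB mulr2n; lra.
rewrite -sqrtrM//; apply: le_trans (ler_norm _) _.
rewrite -sqrtr_sqr; apply: ler_wsqrtr; rewrite -subr_ge0.
rewrite (_ : _ - _ = (a * b' - a' * b) ^+ 2 + (a * c' - a' * c) ^+ 2 +
  (b * c' - b' * c) ^+ 2); first exact: S0.
by ring.
Qed.

End hypot.

Section energy_space_closure.
Context {R : realType} {N : nat}.
Variables (s q : R) (Omega : set 'rV[R]_N).
Hypotheses (q1 : 1 < q) (oOmega : open Omega) (bOmega : bounded_set Omega).
Let q0 : 0 < q := lt_trans ltr01 q1.
Local Notation V := ('rV[R]_N).
Local Notation leb := (@lebesgue_rV R N).
Implicit Types u v w f g h : V -> R.
Local Notation gsq := (gagliardo_sq s).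
Local Notation dq := (dist_q q).
Local Notation approximable := (approximable s q Omega).
Let mr := @measurable_riesz R N s.
Let r0 := @riesz_ge0 R N s.

Let mOmega : measurable Omega := measurable_Omega oOmega.
Let Omega_lty : (leb Omega < +oo)%E := bounded_measure bOmega mOmega.

Lemma int_indic_Omega (c : R) : 0 <= c ->
  (\int[leb]_x (c * \1_Omega x)%:E)%E = (c * fine (leb Omega))%:E.
Proof.
move=> c0; under eq_integral do rewrite EFinM.
rewrite ge0_integralZl//; last exact/measurable_EFinP.
by rewrite integral_indic// setIT EFinM fineK// ge0_fin_numE.
Qed.

Lemma dist_q_combine (K e : R) u v h f g phi : 0 <= K -> 0 <= e ->
  measurable_fun setT u -> measurable_fun setT v -> measurable_fun setT h ->
  measurable_fun setT f -> measurable_fun setT g -> measurable_fun setT phi ->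
  (forall x, ~ Omega x -> phi x = h x) ->
  (forall x, `|phi x - h x| <= K * (`|f x - u x| + `|g x - v x|) + e) ->
  (dq phi h <= (2 `^ q * K `^ q * 2 `^ q)%:E * (dq f u + dq g v) +
     (2 `^ q * e `^ q * fine (leb Omega))%:E)%E.
Proof.
move=> K0 e0 mu mv mh mf mg mp ph hb.
have mI w w' : measurable_fun setT w -> measurable_fun setT w' ->
    measurable_fun setT (fun x => (`|w x - w' x| `^ q)%:E).
  move=> mw mw'; apply/measurable_EFinP; apply: measurable_powR_norm.
  exact: measurable_funB.
have c0 : 0 <= 2 `^ q * e `^ q by rewrite mulr_ge0 ?powR_ge0.
rewrite -int_indic_Omega// /dist_q -ge0_integralD//; last 2 first.
- exact: mI.
- exact: mI.
have A0 : 0 <= 2 `^ q * K `^ q * 2 `^ q by rewrite !mulr_ge0 ?powR_ge0.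
have mS : measurable_fun setT
    (fun x => ((`|f x - u x| `^ q)%:E + (`|g x - v x| `^ q)%:E)%E).
  by apply: emeasurable_funD; exact: mI.
have S0 x : (0 <= (`|f x - u x| `^ q)%:E + (`|g x - v x| `^ q)%:E)%E.
  by rewrite -EFinD lee_fin addr_ge0// powR_ge0.
rewrite -ge0_integralZl//.
rewrite -ge0_integralD//; last 4 first.
- by move=> x _; rewrite mule_ge0.
- exact: measurable_funeM.
- by move=> x _; rewrite lee_fin mulr_ge0.
- by apply/measurable_EFinP; exact: measurable_funM.
apply: ge0_le_integral => //.
- exact: mI.
- apply: emeasurable_funD; first exact: measurable_funeM.
  by apply/measurable_EFinP; exact: measurable_funM.
move=> x _; rewrite lee_fin.
have [Ox|nOx] := pselect (Omega x); last first.
  rewrite ph// subrr normr0 powR0 ?gt_eqF//.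
  by rewrite addr_ge0// mulr_ge0// addr_ge0// powR_ge0.
rewrite indicE mem_set// mulr1.
apply: (@le_trans _ _ ((K * (`|f x - u x| + `|g x - v x|) + e) `^ q)).
  exact: ler_powR_q.
have ab0 : 0 <= `|f x - u x| + `|g x - v x| by rewrite addr_ge0.
have := powR_norm_add q1 (K * (`|f x - u x| + `|g x - v x|)) e.
have Kab0 := mulr_ge0 K0 ab0.
rewrite (ger0_norm Kab0) (ger0_norm e0) (ger0_norm (addr_ge0 Kab0 e0)).
move=> /le_trans; apply.
rewrite mulrDr lerD2r powRM// -!mulrA.
rewrite !ler_wpM2l ?powR_ge0//.
have := powR_norm_add q1 `|f x - u x| `|g x - v x|.
by rewrite !normr_id (ger0_norm ab0).
Qed.

Lemma gagliardo_sq_combine (K : R) f g phi : 0 <= K ->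
  measurable_fun setT f -> measurable_fun setT g -> measurable_fun setT phi ->
  (forall z, increment phi z ^+ 2 <=
    K * (increment f z ^+ 2 + increment g z ^+ 2)) ->
  (gsq phi <= K%:E * (gsq f + gsq g))%E.
Proof.
move=> K0 mf mg mp hb.
have mI w : measurable_fun setT w ->
    measurable_fun setT (fun z => (increment w z ^+ 2 * riesz s z)%:E).
  move=> mw; apply/measurable_EFinP.
  by apply: measurable_wsq => //; exact: measurable_increment.
have I0 w z : (0 <= (increment w z ^+ 2 * riesz s z)%:E)%E.
  by rewrite lee_fin; exact: (wsq_ge0 r0 (increment w)).
rewrite !gagliardo_sqE -ge0_integralD//; [|exact: mI..].
rewrite -ge0_integralZl//; last 2 first.
- by apply: emeasurable_funD; exact: mI.
- by move=> z _; rewrite adde_ge0.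
apply: ge0_le_integral => //.
- exact: mI.
- by apply: measurable_funeM; apply: emeasurable_funD; exact: mI.
move=> z _; rewrite -EFinD -EFinM lee_fin -mulrDl mulrA.
by apply: ler_wpM2r.
Qed.

(** The common pattern of the stability results: it is enough to combine the
    approximants of [u] and [v] with control of increments and of distances. *)
Lemma approximable_combine (K : R) u v h : 0 <= K ->
  approximable u -> approximable v -> measurable_fun setT h ->
  (forall x, ~ Omega x -> h x = 0) ->
  (forall e f g, 0 < e -> test_function Omega f -> test_function Omega g ->
    exists phi, [/\ test_function Omega phi,
      forall z, increment phi z ^+ 2 <=
        K * (increment f z ^+ 2 + increment g z ^+ 2) &
      forall x, `|phi x - h x| <= K * (`|f x - u x| + `|g x - v x|) + e]) ->
  approximable h.
Proof.
move=> K0 [mu u0 [C1 uC]] [mv v0 [C2 vC]] mh h0 hphi.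
split => //; exists (K * (C1 + C2)) => e e0.
set A := 2 `^ q * K `^ q * 2 `^ q.
have A0 : 0 <= A by rewrite !mulr_ge0 ?powR_ge0.
set m := fine (leb Omega).
have m0 : 0 <= m by rewrite fine_ge0.
have two0 : 0 < 2 `^ q :> R by exact: powR_gt0.
(* [e1] makes the part of the distance due to the approximants at most [e / 2],
   [e2] does the same for the constant error over [Omega] *)
pose e1 := e / (4 * (A + 1)).
have A1 : 0 < A + 1 by lra.
have m1 : 0 < m + 1 by lra.
have e10 : 0 < e1 by rewrite divr_gt0// mulr_gt0.
pose e2 := (e / (2 * (2 `^ q * (m + 1)))) `^ q^-1.
have d0 : 0 < e / (2 * (2 `^ q * (m + 1))) by rewrite divr_gt0// !mulr_gt0.
have e20 : 0 < e2 by exact: powR_gt0.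
have [f [tf fC fu]] := uC _ e10.
have [g [tg gC gv]] := vC _ e10.
have [phi [tp p1 p2]] := hphi _ _ _ e20 tf tg.
have mt w : test_function Omega w -> measurable_fun setT w.
  exact: test_function_measurable.
exists phi; split => //.
  apply: (le_trans (gagliardo_sq_combine K0 (mt _ tf) (mt _ tg) (mt _ tp) p1)).
  by rewrite EFinM lee_wpmul2l ?lee_fin// EFinD leeD.
apply: (le_trans (@dist_q_combine K e2 u v h f g phi _ _ _ _ _ _ _ _ _ _)) =>
  //.
- exact: ltW.
- exact: mt.
- exact: mt.
- exact: mt.
- by move=> x nx; rewrite h0// (test_function_out tp nx).
rewrite -/A -/m.
apply: (@le_trans _ _ (A%:E * (e1%:E + e1%:E) + (e / 2)%:E)%E).
  apply: leeD.
    by apply: lee_wpmul2l; [rewrite lee_fin|exact: (leeD fu gv)].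
  rewrite lee_fin /e2 -powRrM mulVf ?gt_eqF// powRr1 ?(ltW d0)//.
  have -> : 2 `^ q * (e / (2 * (2 `^ q * (m + 1)))) * m = e / 2 * (m / (m + 1)).
    by field; apply/andP; split; rewrite gt_eqF.
  rewrite -[X in _ <= X]mulr1; apply: ler_wpM2l; first by lra.
  by rewrite ler_pdivrMr// mul1r lerDl.
rewrite lee_fin /e1.
rewrite (_ : A * _ = e / 2 * (A / (A + 1))); last by field; rewrite gt_eqF.
have : A / (A + 1) <= 1 by rewrite ler_pdivrMr// mul1r lerDl.
move: (A / (A + 1)) => t; nra.
Qed.

Lemma approximable0 : approximable (cst 0).
Proof.
split => //; exists 0 => e e0; exists (cst 0); split;
  first exact: test_function0.
  rewrite gagliardo_sqE integral0_eq// => z _.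
  by rewrite /increment /= subrr expr0n /= mul0r.
rewrite /dist_q integral0_eq ?lee_fin ?ltW// => x _.
by rewrite subrr normr0 powR0// gt_eqF.
Qed.

Lemma approximable_add u v : approximable u -> approximable v ->
  approximable (u \+ v).
Proof.
move=> au av; have [[mu u0 _] [mv v0 _]] := (au, av).
apply: (@approximable_combine 2 u v) => //.
- exact: measurable_funD.
- by move=> x nx /=; rewrite u0// v0// addr0.
move=> e f g e0 tf tg; exists (f \+ g); split.
- exact: test_function_add.
- move=> z; rewrite increment_add.
  move: (increment f z) (increment g z) => a b.
  by have := sqr_ge0 (a - b); nra.
- move=> x /=; rewrite (_ : _ - _ = (f x - u x) + (g x - v x)); last by ring.
  have := ler_normD (f x - u x) (g x - v x).
  by have := normr_ge0 (f x - u x); have := normr_ge0 (g x - v x); lra.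
Qed.

Lemma approximable_scale c u : approximable u -> approximable (c \*o u).
Proof.
move=> au; have [mu u0 _] := au.
have c2 : 0 <= c ^+ 2 by exact: sqr_ge0.
have c1 : 0 <= `|c| by exact: normr_ge0.
apply: (@approximable_combine (c ^+ 2 + `|c|) u u) => //.
- exact: addr_ge0.
- exact: measurable_funM.
- by move=> x nx /=; rewrite u0// mulr0.
move=> e f g e0 tf tg; exists (c \*o f); split.
- exact: test_function_scale.
- move=> z; rewrite increment_scale exprMn.
  have := sqr_ge0 (increment f z); have := sqr_ge0 (increment g z).
  move: c2; move: (_ ^+ 2) (_ ^+ 2) (_ ^+ 2) => a b d; nra.
- move=> x /=; rewrite -mulrBr normrM.
  have := normr_ge0 (f x - u x); have := normr_ge0 (g x - u x).
  move: c1 c2; move: (_ ^+ 2) `|c| `|f x - _| `|g x - _| => a b d k; nra.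
Qed.

Definition hypot u v x : R := Num.sqrt (u x ^+ 2 + v x ^+ 2).

(** Hence the energy of [sqrt (u^2 + v^2)] is at most the sum of the energies of
    [u] and [v]: the convexity of the energy along such curves. *)
Lemma increment_hypot u v z :
  increment (hypot u v) z ^+ 2 <= increment u z ^+ 2 + increment v z ^+ 2.
Proof.
have := sqrt3_lipschitz (u z.1) (v z.1) 0 (u z.2) (v z.2) 0.
by rewrite subrr !expr0n /= !addr0.
Qed.

Lemma measurable_hypot u v : measurable_fun setT u -> measurable_fun setT v ->
  measurable_fun setT (hypot u v).
Proof.
move=> mu mv.
rewrite (_ : hypot u v = (fun x => (u x ^+ 2 + v x ^+ 2) `^ 2^-1)).
  apply: (measurableT_comp (measurable_powR _)).
  by apply: measurable_funD; exact: measurable_funX.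
by apply/funext => x; rewrite powR12_sqrt// addr_ge0// sqr_ge0.
Qed.

Lemma approximable_hypot u v : approximable u -> approximable v ->
  approximable (hypot u v).
Proof.
move=> au av; have [[mu u0 _] [mv v0 _]] := (au, av).
apply: (@approximable_combine 1 u v) => //.
- exact: measurable_hypot.
- by move=> x nx; rewrite /hypot u0// v0// expr0n addr0 sqrtr0.
move=> e f g e0 tf tg.
have e2 : 0 < e / 2 by rewrite divr_gt0.
exists (fun x => Num.sqrt (f x ^+ 2 + g x ^+ 2 + (e / 2) ^+ 2) - e / 2); split.
- exact: test_function_hypot.
- move=> z; rewrite mul1r /increment.
  have := sqrt3_lipschitz (f z.1) (g z.1) (e / 2) (f z.2) (g z.2) (e / 2).
  rewrite [e / 2 - e / 2]subrr expr0n /= addr0.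
  set S := Num.sqrt _; set T := Num.sqrt _ => ST.
  by rewrite (_ : S - e / 2 - (T - e / 2) = S - T)//; ring.
- move=> x; rewrite mul1r /hypot.
  have := sqrt3_lipschitz (f x) (g x) (e / 2) (u x) (v x) 0.
  rewrite subr0 expr0n /= addr0.
  set S := Num.sqrt _; set T := Num.sqrt _ => ST.
  have {ST} : `|S - T| <= `|f x - u x| + `|g x - v x| + e / 2.
    rewrite -(@ler_pXn2r _ 2) ?nnegrE ?addr_ge0 ?(ltW e2)// real_normK
      ?num_real//.
    apply: le_trans ST _; rewrite -(real_normK (num_real (f x - u x))).
    rewrite -(real_normK (num_real (g x - v x))).
    have := normr_ge0 (f x - u x); have := normr_ge0 (g x - v x).
    move: `|f x - _| `|g x - _| (e / 2) e2 => a b d d0 b0 a0.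
    have := mulr_ge0 a0 b0; have := mulr_ge0 a0 (ltW d0).
    have := mulr_ge0 b0 (ltW d0); nra.
  have := ler_normB (S - T) (e / 2); rewrite (ger0_norm (ltW e2)).
  rewrite (_ : S - T - e / 2 = S - e / 2 - T); last by ring.
  move: `|_ - T| `|S - T| => a b; move: `|_ - _| `|_ - _| => c d; lra.
Qed.

Lemma hypot0 u : hypot u (cst 0) = (fun x => `|u x|).
Proof. by apply/funext => x; rewrite /hypot /= expr0n addr0 sqrtr_sqr. Qed.

Lemma approximable_norm u : approximable u -> approximable (fun x => `|u x|).
Proof. by rewrite -hypot0 => au; apply: approximable_hypot approximable0. Qed.

Lemma approximable_sub u v : approximable u -> approximable v ->
  approximable (u \- v).
Proof.
move=> au av; rewrite (_ : _ \- _ = u \+ (-1 \*o v)).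
  exact: (approximable_add au (approximable_scale (-1) av)).
by apply/funext => x /=; ring.
Qed.

Definition pos u x : R := Num.max (u x) 0.
Definition neg u x : R := Num.max (- u x) 0.

Lemma pos_ge0 u x : 0 <= pos u x.
Proof. by rewrite /pos le_max lexx orbT. Qed.

Lemma neg_ge0 u x : 0 <= neg u x.
Proof. by rewrite /neg le_max lexx orbT. Qed.

Lemma posE u : pos u = 2^-1 \*o (u \+ (fun x => `|u x|)).
Proof.
apply/funext => x; rewrite /pos /=; case: (leP 0 (u x)) => ux.
  by rewrite ger0_norm//; lra.
by rewrite ltr0_norm//; lra.
Qed.

Lemma negE u : neg u = 2^-1 \*o ((fun x => `|u x|) \- u).
Proof.
apply/funext => x; rewrite /neg /=; case: (leP 0 (u x)) => ux.
  by rewrite ger0_norm// max_r; lra.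
by rewrite ltr0_norm// max_l; lra.
Qed.

Lemma approximable_pos u : approximable u -> approximable (pos u).
Proof.
move=> au; rewrite posE.
exact: (approximable_scale _ (approximable_add au (approximable_norm au))).
Qed.

Lemma approximable_neg u : approximable u -> approximable (neg u).
Proof.
move=> au; rewrite negE.
exact: (approximable_scale _ (approximable_sub (approximable_norm au) au)).
Qed.

Lemma test_function_bounded f : test_function Omega f ->
  exists2 M : R, 0 <= M & forall x, `|f x| <= M.
Proof.
move=> tf; have [sf kf _] := tf.
set S := closure _ in kf.
have : compact (f @` S).
  apply: continuous_compact => //.
  by apply: continuous_subspaceT; exact: smooth_continuous.
move=> /compact_bounded[M [_ /(_ (Num.max 0 M + 1))]].
have M1 : M < Num.max 0 M + 1 by rewrite ltr_pwDr// le_max lexx orbT.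
move=> /(_ M1) MP; exists (Num.max 0 M + 1).
  by rewrite addr_ge0// le_max lexx.
move=> x; have [fx0|fx0] := eqVneq (f x) 0.
  by rewrite fx0 normr0 addr_ge0// le_max lexx.
by apply: MP; exists x => //; apply: subset_closure.
Qed.

(** Test functions are bounded and [Omega] has finite measure. *)
Lemma D0s2_lq_finite u : D0s2 s q Omega u ->
  (\int[leb]_x (`|u x| `^ q)%:E < +oo)%E.
Proof.
move=> [mu u0 [f [tf _ fu]]].
have [n _ nP] : \forall n \near \oo,
    (\int[leb]_(x in Omega) (`|f n x - u x| `^ q)%:E < 1%:E)%E.
  apply: (fu [set y | y < 1%:E]%E).
  by apply: open_ereal_lt'; rewrite lte_fin.
have {nP} := nP n (leqnn _).
rewrite (dist_qE q1) => [d1||//]; last by move=> x; exact: test_function_out.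
have [M M0 fM] := test_function_bounded (tf n).
have z0 : dq (cst 0 : V -> R) (cst 0 : V -> R) = 0%E.
  rewrite /dist_q integral0_eq// => x _.
  by rewrite subrr normr0 powR0// gt_eqF.
have := @dist_q_combine 1 M u (cst 0) (cst 0) (f n) (cst 0) u ler01 M0.
rewrite z0 adde0 /dist_q.
under eq_integral do rewrite subr0.
move=> h; apply: le_lt_trans (h _ _ _ _ _ _ _ _) _ => //.
- exact: test_function_measurable (tf n).
- move=> x /=; rewrite subr0 mul1r subrr normr0 addr0.
  have := fM x; have := ler_normB (f n x) (f n x - u x).
  rewrite (_ : f n x - (f n x - u x) = u x); last by ring.
  move: `|u x| `|f n x| `|_ - _| => a b c; lra.
- by rewrite lte_add_pinfty ?ltry// lte_mul_pinfty// (lt_trans d1)// ltry.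
Qed.

End energy_space_closure.

(** * Supersolutions: maximum principle, Picone inequality, uniqueness *)

Section product_integral.
Context {R : realType} {N : nat}.
Local Notation V := ('rV[R]_N).
Local Notation leb := (@lebesgue_rV R N).
Implicit Types a c : V -> R.

Lemma measurable_tensor a c : measurable_fun setT a -> measurable_fun setT c ->
  measurable_fun setT (fun z : V * V => a z.1 * c z.2).
Proof.
move=> ma mc; apply: measurable_funM.
  exact: (measurableT_comp ma measurable_fst).
exact: (measurableT_comp mc measurable_snd).
Qed.

Lemma integral_tensor a c : measurable_fun setT a -> measurable_fun setT c ->
  (forall x, 0 <= a x) -> (forall x, 0 <= c x) ->
  (\int[leb \x leb]_z (a z.1 * c z.2)%:E =
   \int[leb]_x (a x)%:E * \int[leb]_y (c y)%:E)%E.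
Proof.
move=> ma mc a0 c0; rewrite fubini_tonelli1 /fubini_F /=; last 2 first.
- by apply/measurable_EFinP; exact: measurable_tensor.
- by move=> z; rewrite lee_fin mulr_ge0.
rewrite -ge0_integralZr//; last 3 first.
- exact/measurable_EFinP.
- by move=> x _; rewrite lee_fin.
- by apply: integral_ge0 => x _; rewrite lee_fin.
apply: eq_integral => x _; under eq_integral do rewrite EFinM.
have mc' : measurable_fun setT (EFin \o c) by exact/measurable_EFinP.
by rewrite ge0_integralZl// ?lee_fin// => y _; rewrite lee_fin.
Qed.

Lemma riesz_gt0 s (z : V * V) : z.1 != z.2 -> 0 < riesz s z.
Proof.
move=> z12; rewrite invr_gt0 powR_gt0// lt_neqAle sqrtr_ge0 andbT eq_sym.
apply: contra_neq z12 => /eqP; rewrite sqrtr_eq0 => e0.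
have sq0 j : true -> 0 <= (z.1 - z.2) ord0 j ^+ 2 by move=> _; exact: sqr_ge0.
have S0 : \sum_(j < N) (z.1 - z.2) ord0 j ^+ 2 = 0.
  by apply/eqP; rewrite eq_le e0; exact: sumr_ge0.
apply/rowP => i; apply/eqP; rewrite -subr_eq0 -sqrf_eq0.
by have := psumr_eq0P sq0 S0 (i := i) isT; rewrite !mxE => ->.
Qed.

(** The kernel is positive off the diagonal, and [a] and [c] have disjoint
    supports, so a vanishing interaction makes [a(x) c(y)] vanish almost
    everywhere; by Tonelli one of the factors does. *)
Lemma tensor_riesz_eq0 s a c : measurable_fun setT a -> measurable_fun setT c ->
  (forall x, 0 <= a x) -> (forall x, 0 <= c x) -> (forall x, a x * c x = 0) ->
  (\int[leb \x leb]_z (a z.1 * c z.2 * riesz s z)%:E <= 0)%E ->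
  (\int[leb]_x (a x)%:E = 0 \/ \int[leb]_x (c x)%:E = 0)%E.
Proof.
move=> ma mc a0 c0 ac i0.
have mT := measurable_tensor ma mc.
have mF : measurable_fun setT (fun z => a z.1 * c z.2 * riesz s z).
  by apply: measurable_funM => //; exact: measurable_riesz.
have F0 z : 0 <= a z.1 * c z.2 * riesz s z.
  by rewrite !mulr_ge0// riesz_ge0.
have /ae_eq_integral_abs : (\int[leb \x leb]_z
    `|(a z.1 * c z.2 * riesz s z)%:E| = 0)%E.
  apply/eqP; rewrite eq_le integral_ge0// andbT.
  by under eq_integral do rewrite gee0_abs ?lee_fin//.
move=> /(_ measurableT); rewrite measurable_EFinP => /(_ mF) ae0.
have : (\int[leb]_x (a x)%:E * \int[leb]_y (c y)%:E = 0)%E.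
  rewrite -integral_tensor//.
  have -> : (\int[leb \x leb]_z (a z.1 * c z.2)%:E =
     \int[leb \x leb]_z cst 0 z)%E.
    apply: ge0_ae_eq_integral => //.
    - exact/measurable_EFinP.
    - by move=> z _; rewrite lee_fin mulr_ge0.
    - apply: filterS ae0 => z /(_ I) /eqP /=;
      rewrite eqe mulf_eq0 => /orP[/eqP -> //|].
      have [z12 _|/(riesz_gt0 s) K0] := eqVneq z.1 z.2; first by rewrite z12 ac.
      by rewrite gt_eqF.
  exact: integral0.
by move=> /eqP; rewrite mule_eq0 => /orP[/eqP|/eqP]; [left|right].
Qed.

End product_integral.

Section supersolutions.
Context {R : realType} {N : nat}.
Variables (s q : R) (Omega : set 'rV[R]_N).
Hypotheses (q1 : 1 < q) (q2 : q < 2).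
Hypotheses (oOmega : open Omega) (bOmega : bounded_set Omega).
Let q0 : 0 < q := lt_trans ltr01 q1.
Let qm0 : 0 < q - 1. Proof. by rewrite subr_gt0. Qed.
Local Notation V := ('rV[R]_N).
Local Notation leb := (@lebesgue_rV R N).
Implicit Types u v w f g h z b phi : V -> R.
Local Notation approximable := (approximable s q Omega).
Local Notation dotG := (dotG s).
Let mr := @measurable_riesz R N s.
Let r0 := @riesz_ge0 R N s.

Lemma approximable_lq u : approximable u ->
  leb.-integrable setT (EFin \o (fun x => `|u x| `^ q)).
Proof.
move=> au; apply: int_real_lty.
- by apply: measurable_powR_norm; have [] := au.
- by move=> x; exact: powR_ge0.
- exact: (D0s2_lq_finite q1 oOmega bOmega (approximable_D0s2 q1 au)).
Qed.

Lemma powR_prod_le (a b : R) : 0 <= a -> 0 <= b ->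
  a `^ (q - 1) * b <= a `^ q + b `^ q.
Proof.
move=> a0 b0; have [ba|ab] := leP b a.
  rewrite -(mulr_powRB1 a0 q0) mulrC; apply: (@le_trans _ _ (a * a `^ (q - 1))).
    by rewrite ler_wpM2r ?powR_ge0.
  by rewrite lerDl powR_ge0.
rewrite -(mulr_powRB1 b0 q0) mulrC; apply: (@le_trans _ _ (b * b `^ (q - 1))).
  by rewrite ler_wpM2l// ge0_ler_powR ?nnegrE// ltW.
by rewrite lerDr powR_ge0.
Qed.

Lemma measurable_powR_comp u (r : R) : measurable_fun setT u ->
  measurable_fun setT (fun x => u x `^ r).
Proof. by move=> mu; apply: (measurableT_comp (measurable_powR _)). Qed.

Lemma integrable_source u phi : approximable u -> approximable phi ->
  leb.-integrable setT (EFin \o (fun x => `|u x| `^ (q - 1) * phi x)).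
Proof.
move=> au ap; have [[mu _ _] [mp _ _]] := (au, ap).
apply: le_integrable
  (integrableD measurableT (approximable_lq au) (approximable_lq ap)) => //.
  apply/measurable_EFinP; apply: measurable_funM => //.
  by apply: measurable_powR_comp; exact: measurableT_comp.
move=> x _ /=; rewrite lee_fin normrM (ger0_norm (powR_ge0 _ _)).
rewrite [leRHS]ger0_norm ?addr_ge0 ?powR_ge0//.
exact: powR_prod_le.
Qed.

(** Nonnegative critical points satisfy these conditions with equalities.  For
    a minimiser over the cone of nonnegative functions they come from comparison
    with larger functions and with its own multiples. *)
Definition supersolution z := [/\ approximable z, forall x, 0 <= z x,
  forall phi, approximable phi -> (forall x, 0 <= phi x) ->
    \int[leb]_x (z x `^ (q - 1) * phi x) <= dotG z phi &
  dotG z z <= \int[leb]_x (z x `^ q)].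

Lemma integrable_lq z : approximable z -> (forall x, 0 <= z x) ->
  leb.-integrable setT (EFin \o (fun x => z x `^ q)).
Proof.
move=> az z0; have := approximable_lq az.
by rewrite (_ : (fun x => `|z x| `^ q) = (fun x => z x `^ q))//;
  apply/funext => x; rewrite ger0_norm.
Qed.

Lemma integrable_source_ge0 z phi : approximable z -> (forall x, 0 <= z x) ->
  approximable phi ->
  leb.-integrable setT (EFin \o (fun x => z x `^ (q - 1) * phi x)).
Proof.
move=> az z0 ap; have := integrable_source az ap.
by rewrite (_ : (fun x => `|z x| `^ _ * _) = (fun x => z x `^ (q - 1) * phi
  x))//;
  apply/funext => x; rewrite ger0_norm.
Qed.

(** Where supports are disjoint, [(u x - u y) (v x - v y)] reduces to
    [- u x v y - u y v x].  This is the nonlocal interaction. *)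
Lemma cross_term u v : finite_energy s u -> finite_energy s v ->
  measurable_fun setT u -> measurable_fun setT v ->
  (forall x, 0 <= u x) -> (forall x, 0 <= v x) -> (forall x, u x * v x = 0) ->
  (\int[leb \x leb]_z (u z.1 * v z.2 * riesz s z)%:E <= (- dotG u v)%:E)%E.
Proof.
move=> fu fv mu mv u0 v0 uv.
have mT : measurable_fun setT (fun z : V * V => u z.1 * v z.2 * riesz s z).
  by apply: measurable_funM => //; exact: measurable_tensor.
have -> : (- dotG u v)%:E = (\int[leb \x leb]_z
    (-1 * (increment u z * increment v z * riesz s z))%:E)%E.
  under eq_integral do rewrite EFinM.
  rewrite integralZl//; last exact: wL2_integrable fu fv.
  by rewrite (wdotE mr r0 fu fv) -EFinM mulN1r.
have mI : measurable_fun setT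
    (fun z : V * V => -1 * (increment u z * increment v z * riesz s z)).
  apply: measurable_funM => //; apply: measurable_wdot => //;
    exact: measurable_increment.
apply: le_int_real => // z; first by rewrite !mulr_ge0.
rewrite !mulrA; apply: ler_wpM2r => //; rewrite /increment.
have := uv z.1; have := uv z.2; have := mulr_ge0 (u0 z.2) (v0 z.1).
move: (u z.1) (u z.2) (v z.1) (v z.2) => a b c d bc bd ac; nra.
Qed.

Lemma pos_neg_mul u x : pos u x * neg u x = 0.
Proof.
by rewrite /pos /neg; case: (leP 0 (u x)) => ux;
  [rewrite max_r ?mulr0// oppr_le0|rewrite mul0r].
Qed.

Lemma pos_neg_sub u : pos u \- neg u = u.
Proof.
apply/funext => x; rewrite /pos /neg /=; case: (leP 0 (u x)) => ux.
  by rewrite max_r ?subr0// oppr_le0.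
by rewrite max_l ?opprK ?add0r// oppr_ge0 ltW.
Qed.

Lemma approximable_measurable u : approximable u -> measurable_fun setT u.
Proof. by case. Qed.

(* the properties of the energy space with the standing hypotheses supplied *)
Let aF u (a : approximable u) : finite_energy s u := approximable_finite q1 a.
Let aZ c u (a : approximable u) : approximable (c \*o u) :=
  approximable_scale q1 oOmega bOmega c a.
Let aB u v (a : approximable u) (b : approximable v) : approximable (u \- v) :=
  approximable_sub q1 oOmega bOmega a b.
Let apos u (a : approximable u) : approximable (pos u) :=
  approximable_pos q1 oOmega bOmega a.
Let aneg u (a : approximable u) : approximable (neg u) :=
  approximable_neg q1 oOmega bOmega a.

(** Write [h = b - l z], so that [l z = b - h], and test [z] with [h^+]:
    [0 <= l <z, h^+> = <b, h^+> - E(h^+) + <h^-, h^+>].  Young's inequality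
    absorbs the first term on the right into [E(h^+)], at the price of [E(b) / 4]. *)
Lemma smp_bound z b (l : R) : supersolution z -> approximable b ->
  (forall x, 0 <= b x) -> 0 < l ->
  (\int[leb \x leb]_y (pos (b \- (l \*o z)) y.1 * neg (b \- (l \*o z)) y.2 *
     riesz s y)%:E <= (dotG b b / 4)%:E)%E.
Proof.
move=> [az z0 zsup _] ab b0 l0.
set h := b \- (l \*o z).
have ah : approximable h := aB ab (aZ l az).
have [ap an] := (apos ah, aneg ah).
have [[[fb fz] fp] fn] := (aF ab, aF az, aF ap, aF an).
have ct := cross_term fp fn (approximable_measurable ap)
  (approximable_measurable an) (pos_ge0 h) (neg_ge0 h) (pos_neg_mul h).
apply: le_trans ct _.
have zp : 0 <= dotG z (pos h).
  apply: le_trans (zsup _ ap (pos_ge0 h)).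
  by apply: Rintegral_ge0 => x _; rewrite mulr_ge0 ?powR_ge0 ?pos_ge0.
have E : dotG (pos h \- neg h) (pos h) = dotG b (pos h) - l * dotG z (pos h).
  by rewrite pos_neg_sub /h dotGBl// ?dotGZl//; exact: finite_energyZ.
rewrite dotGBl// in E.
have Y := dotG_young (finite_energyZ 2^-1 fb) fp.
rewrite !dotGZl// ?dotGZr// in Y; last exact: finite_energyZ.
rewrite lee_fin (dotGC s (pos h)).
have := mulr_ge0 (ltW l0) zp.
move: E Y; move: (dotG (neg h) (pos h)) (dotG (pos h) (pos h)) (dotG b (pos h))
  (dotG b b) (l * dotG z (pos h)) => c d e f g; lra.
Qed.

(** In [smp_bound] divide by [l] and let [l] grow.  On the zero set of [z] the
    function [(b - l z)^+] is [b], while [(b - l z)^- / l] tends to [z]: in the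
    limit [b] restricted to [z = 0] does not interact with [z]. *)
Lemma strong_maximum z b : supersolution z -> approximable b ->
  (forall x, 0 <= b x) -> (\int[leb]_x (z x)%:E != 0)%E ->
  {ae leb, forall x, z x = 0 -> b x = 0}.
Proof.
move=> sz ab b0 zn0; have [az z0 _ _] := sz.
have [mz mb] := (approximable_measurable az, approximable_measurable ab).
pose Z : set V := z @^-1` [set 0].
have mZ : measurable Z by rewrite -[Z]setTI; exact: mz.
pose a x := b x * \1_Z x.
have ma : measurable_fun setT a by exact: measurable_funM.
have a0 x : 0 <= a x by rewrite mulr_ge0.
have az0 x : a x * z x = 0.
  rewrite /a indicE; case: (boolP (x \in Z)) => [|_];
    last by rewrite mulr0 mul0r.
  by rewrite inE /Z /= => ->; rewrite mulr0.
have mc l : measurable_fun setT (pos (z \- (l^-1 \*o b))).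
  exact: approximable_measurable (apos (aB az (aZ l^-1 ab))).
have bnd l : 0 < l -> (\int[leb \x leb]_y
    (a y.1 * pos (z \- (l^-1 \*o b)) y.2 * riesz s y)%:E <=
    (l^-1 * (dotG b b / 4))%:E)%E.
  move=> l0; apply: (@le_trans _ _ (l^-1%:E * \int[leb \x leb]_y
    (pos (b \- (l \*o z)) y.1 * neg (b \- (l \*o z)) y.2 * riesz s y)%:E)%E).
    have mh : measurable_fun setT (fun y : V * V => pos (b \- (l \*o z)) y.1 *
        neg (b \- (l \*o z)) y.2 * riesz s y).
      have ah : approximable (b \- (l \*o z)) := aB ab (aZ l az).
      apply: measurable_funM => //; apply: measurable_tensor.
        exact: approximable_measurable (apos ah).
      exact: approximable_measurable (aneg ah).
    rewrite -ge0_integralZl//; last 3 first.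
    - exact/measurable_EFinP.
    - by move=> y _; rewrite lee_fin !mulr_ge0 ?pos_ge0 ?neg_ge0.
    - by rewrite lee_fin invr_ge0 ltW.
    under [leRHS]eq_integral do rewrite -EFinM.
    apply: le_int_real.
    - by apply: measurable_funM => //; exact: measurable_tensor.
    - exact: measurable_funM.
    - by move=> y; rewrite !mulr_ge0 ?pos_ge0.
    - move=> y; rewrite !mulrA; apply: ler_wpM2r => //.
      have -> : neg (b \- (l \*o z)) y.2 = l * pos (z \- (l^-1 \*o b)) y.2.
        rewrite /neg /pos /= maxr_pMr ?ltW// mulr0 mulrBr mulrA divff ?gt_eqF//.
        by rewrite mul1r opprB.
      rewrite mulrA [_ * l]mulrC mulrA divff ?gt_eqF// mul1r.
      apply: ler_wpM2r; first exact: pos_ge0.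
      rewrite /a indicE; case: (boolP (y.1 \in Z)) => [|_].
        by rewrite inE /Z /= => zy;
          rewrite mulr1 /pos /= zy mulr0 subr0 le_max lexx.
      by rewrite mulr0 pos_ge0.
  by rewrite EFinM lee_wpmul2l ?lee_fin ?invr_ge0 ?(ltW l0)//; exact: smp_bound.
have i0 : (\int[leb \x leb]_y (a y.1 * z y.2 * riesz s y)%:E <= 0)%E.
  apply/lee_addgt0Pr => e e0; rewrite add0e.
  pose n0 := Num.truncn (dotG b b / 4 / e).
  have Cn0 : dotG b b / 4 / e < n0.+1%:R by exact: truncnS_gt.
  apply: (@fatou_ae _ _ _ _ (fun n y =>
    a y.1 * pos (z \- ((n + n0).+1%:R^-1 \*o b)) y.2 * riesz s y)
    (fun y => a y.1 * z y.2 * riesz s y)).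
  - by move=> n; apply: measurable_funM => //; exact: measurable_tensor.
  - by apply: measurable_funM => //; exact: measurable_tensor.
  - by move=> n y; rewrite !mulr_ge0 ?pos_ge0.
  - by move=> y; rewrite !mulr_ge0.
  - apply: aeW => y.
    apply: cvgM; last exact: cvg_cst.
    apply: cvgM; first exact: cvg_cst.
    have c1 : (n + n0).+1%:R^-1 @[n --> \oo] --> (0 : R).
      have := @cvg_harmonic R; rewrite -(cvg_shiftn n0).
      by apply: cvg_trans; apply: near_eq_cvg; apply: nearW.
    have c2 : z y.2 - (n + n0).+1%:R^-1 * b y.2 @[n --> \oo] --> z y.2.
      rewrite -[X in _ --> X]subr0 -(mul0r (b y.2)).
      by apply: cvgB; [exact: cvg_cst|apply: cvgM => //; exact: cvg_cst].
    have zE : z y.2 = 2^-1 * (z y.2 + `|z y.2|).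
      by rewrite ger0_norm//; lra.
    have c3 : 2^-1 * (z y.2 - (n + n0).+1%:R^-1 * b y.2 +
        `|z y.2 - (n + n0).+1%:R^-1 * b y.2|) @[n --> \oo] --> z y.2.
      rewrite [X in _ --> X]zE.
      exact: (cvgM (cvg_cst (2^-1 : R)) (cvgD c2 (cvg_norm c2))).
    move: c3; apply: cvg_trans.
    by apply: near_eq_cvg; apply: nearW => n; rewrite posE.
  - move=> n; apply: le_trans (bnd _ _) _; first by rewrite ltr0n.
    rewrite lee_fin mulrC ler_pdivrMr ?ltr0n//.
    move: Cn0; rewrite ltr_pdivrMr// => /ltW /le_trans; apply.
    by rewrite [leLHS]mulrC ler_wpM2l ?(ltW e0)// ler_nat ltnS leq_addl.
have [ia|iz] := tensor_riesz_eq0 ma mz a0 z0 az0 i0;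
  last by rewrite iz eqxx in zn0.
apply: filterS (ge0_int0_ae ma a0 ia) => x; rewrite /a => ax zx; move: ax.
by rewrite indicE mem_set ?mulr1.
Qed.

Lemma dotG_le_add h u v : finite_energy s h -> finite_energy s u ->
  finite_energy s v ->
  (forall y, increment h y ^+ 2 <= increment u y ^+ 2 + increment v y ^+ 2) ->
  dotG h h <= dotG u u + dotG v v.
Proof.
move=> fh fu fv huv.
rewrite /dotG /wdot -RintegralD//; last 2 first.
- exact: wL2_integrable.
- exact: wL2_integrable.
apply: le_Rintegral => //; first exact: wL2_integrable.
  exact: (integrableD measurableT (wL2_integrable mr r0 fu fu)
    (wL2_integrable mr r0 fv fv)).
by move=> y _; rewrite -mulrDl -!expr2; apply: ler_wpM2r.
Qed.

(** Test [z] with [g = sqrt (z^2 + c^2 b^2)]: by convexity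
    [2 <z, g> <= E(z) + E(g) <= 2 E(z) + c^2 E(b)], and [E(z) <= int z^q]. *)
Lemma picone_bound z b (c : R) : supersolution z -> approximable b -> 0 < c ->
  (\int[leb]_x (z x `^ (q - 1) *
     ((hypot z (c \*o b) x - z x) * (2 / c ^+ 2)))%:E <= (dotG b b)%:E)%E.
Proof.
move=> [az z0 zsup zz] ab c0.
have acb := aZ c ab.
have ag : approximable (hypot z (c \*o b)).
  exact: approximable_hypot q1 oOmega bOmega _ _ az acb.
have [[[fz fb] fcb] fg] := (aF az, aF ab, aF acb, aF ag).
set g := hypot z (c \*o b) in ag fg *.
have ig := integrable_source_ge0 az z0 ag.
have iz := integrable_lq az z0.
have E x : z x `^ (q - 1) * ((g x - z x) * (2 / c ^+ 2)) =
    2 / c ^+ 2 * (z x `^ (q - 1) * g x - z x `^ q).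
  by rewrite -(mulr_powRB1 (z0 x) q0); ring.
under eq_integral do rewrite E.
have iB : leb.-integrable setT
    (EFin \o (fun x => z x `^ (q - 1) * g x - z x `^ q)).
  exact: (integrableB measurableT ig iz).
have iBZ : leb.-integrable setT
    (EFin \o (fun x => 2 / c ^+ 2 * (z x `^ (q - 1) * g x - z x `^ q))).
  exact: (integrableZl measurableT (2 / c ^+ 2) iB).
rewrite Rintegral_EFin// lee_fin RintegralZl// RintegralB//.
have g0 x : 0 <= g x by rewrite /g /hypot sqrtr_ge0.
have h1 := zsup _ ag g0.
have h2 := dotG_young fz fg.
have h3 : dotG g g <= dotG z z + dotG (c \*o b) (c \*o b).
  by apply: dotG_le_add => // y; exact: increment_hypot.
rewrite dotGZl// dotGZr// mulrA -expr2 in h3.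
have c2 : 0 < c ^+ 2 by rewrite exprn_gt0.
rewrite mulrAC ler_pdivrMr//.
move: zz h1 h2 h3; move: (\int[leb]_x _) (\int[leb]_x _) (dotG z z) (dotG z g).
move=> i1 i2 d1 d2; rewrite [dotG b b * _]mulrC; move: (c ^+ 2 * _) => t.
lra.
Qed.

(** The limit [c -> 0] of [picone_bound], since [2 (g - z) / c^2] equals
    [2 b^2 / (g + z)].  With the convention [0 / 0 = 0] the integrand is 0 where
    [z] vanishes. *)
Lemma picone z b : supersolution z -> approximable b ->
  (\int[leb]_x (z x `^ (q - 1) * (b x ^+ 2 / z x))%:E <= (dotG b b)%:E)%E.
Proof.
move=> sz ab; have [az z0 _ _] := sz.
have [mz mb] := (approximable_measurable az, approximable_measurable ab).
have zg c x : z x <= hypot z (c \*o b) x.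
  rewrite /hypot -{1}(ger0_norm (z0 x)) -sqrtr_sqr ler_wsqrtr// lerDl.
  exact: sqr_ge0.
have mv : measurable_fun setT (fun x => (z x)^-1).
  rewrite (_ : (fun x => _) = (fun x => z x `^ (-1))).
    exact: measurable_powR_comp.
  by apply/funext => x; rewrite powR_inv1.
apply: (@fatou_ae _ _ _ _ (fun n x => z x `^ (q - 1) *
  ((hypot z (n.+1%:R^-1 \*o b) x - z x) * (2 / n.+1%:R^-1 ^+ 2)))
  (fun x => z x `^ (q - 1) * (b x ^+ 2 / z x))).
- move=> n; apply: measurable_funM; first exact: measurable_powR_comp.
  apply: measurable_funM => //; apply: measurable_funB => //.
  apply: measurable_hypot => //; exact: measurable_funM.
- apply: measurable_funM; first exact: measurable_powR_comp.
  by apply: measurable_funM => //; exact: measurable_funX.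
- move=> n x; apply: mulr_ge0; first exact: powR_ge0.
  by apply: mulr_ge0; [rewrite subr_ge0|rewrite divr_ge0// sqr_ge0].
- by move=> x; rewrite mulr_ge0 ?powR_ge0// divr_ge0// sqr_ge0.
- apply: aeW => x.
  have [zx|zx] := eqVneq (z x) 0.
    rewrite zx powR0 ?gt_eqF// mul0r.
    by under eq_cvg do rewrite mul0r; exact: cvg_cst.
  have zx0 : 0 < z x by rewrite lt_neqAle eq_sym zx z0.
  apply: cvgM; first exact: cvg_cst.
  have c1 : z x ^+ 2 + (n.+1%:R^-1 * b x) ^+ 2 @[n --> \oo] --> z x ^+ 2.
    have h1 : n.+1%:R^-1 * b x @[n --> \oo] --> (0 : R).
      rewrite -[X in _ --> X](mul0r (b x)).
      by apply: cvgM; [exact: cvg_harmonic|exact: cvg_cst].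
    rewrite -[X in _ --> X]addr0 -[X in _ --> _ + X](mul0r (0 : R)).
    exact: (cvgD (cvg_cst _) (cvgM h1 h1)).
  have c2 : hypot z (n.+1%:R^-1 \*o b) x @[n --> \oo] --> z x.
    rewrite -[X in _ --> X](ger0_norm (z0 x)) -sqrtr_sqr.
    exact: (cvg_comp _ _ c1 (@sqrt_continuous R _)).
  have c3 : 2 * b x ^+ 2 / (hypot z (n.+1%:R^-1 \*o b) x + z x) @[n --> \oo] -->
      b x ^+ 2 / z x.
    rewrite (_ : b x ^+ 2 / z x = 2 * b x ^+ 2 / (z x + z x)); last first.
      have -> : z x + z x = 2 * z x by ring.
      by rewrite -mulf_div divff ?mul1r// pnatr_eq0.
    apply: cvgM; first exact: cvg_cst.
    have zz0 : z x + z x != 0 by rewrite -mulr2n mulrn_eq0.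
    exact: (cvgV zz0 (cvgD c2 (cvg_cst (z x)))).
  move: c3; apply: cvg_trans; apply: near_eq_cvg; apply: nearW => n.
  set g := hypot z _ x.
  have gz : 0 < g + z x by rewrite ltr_wpDl// sqrtr_ge0.
  have g2 : g ^+ 2 = z x ^+ 2 + (n.+1%:R^-1 * b x) ^+ 2.
    by rewrite /g /hypot sqr_sqrtr// addr_ge0// sqr_ge0.
  have -> : b x ^+ 2 = (g ^+ 2 - z x ^+ 2) * n.+1%:R ^+ 2.
    by rewrite g2 addrC addKr exprMn mulrAC -exprMn mulVf ?pnatr_eq0// expr1n
      mul1r.
  by rewrite -exprVn invrK subr_sqr; field; rewrite gt_eqF.
- by move=> n; apply: picone_bound => //; rewrite invr_gt0.
Qed.

(** The gap [D] equals [(a^(q-2) - b^(q-2)) (b^2 - a^2)], and [x ^ (q - 2)] is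
    strictly decreasing. *)
Lemma sublinear_gap (a b : R) : 0 < a -> 0 < b ->
  let D := a `^ (q - 1) * (b ^+ 2 / a) + b `^ (q - 1) * (a ^+ 2 / b) -
    (a `^ q + b `^ q) in
  0 <= D /\ (D = 0 -> a = b).
Proof.
wlog ab : a b / a <= b.
  move=> H a0 b0; have [/H|/ltW /H] := leP a b; first exact.
  move=> /(_ b0 a0) /= [D0 DE]; split.
    by rewrite [X in X - _]addrC [X in _ - X]addrC.
  by rewrite [X in X - _]addrC [X in _ - X]addrC => /DE.
move=> a0 b0.
pose f (x : R) := x `^ (q - 2).
have fE (x : R) : 0 < x -> x `^ (q - 1) = x * f x.
  move=> x0; rewrite /f (_ : q - 2 = q - 1 - 1); last by ring.
  by rewrite mulr_powRB1// ltW.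
have aqE : a `^ q = a ^+ 2 * f a by rewrite -(mulr_powRB1 (ltW a0) q0) fE//
  mulrA.
have bqE : b `^ q = b ^+ 2 * f b by rewrite -(mulr_powRB1 (ltW b0) q0) fE//
  mulrA.
rewrite /= !fE// aqE bqE.
have -> : a * f a * (b ^+ 2 / a) + b * f b * (a ^+ 2 / b) -
    (a ^+ 2 * f a + b ^+ 2 * f b) = (f a - f b) * ((b - a) * (b + a)).
  by field; rewrite !gt_eqF.
have [->|nab] := eqVneq a b; first by rewrite !subrr mul0r.
have {}ab : a < b by rewrite lt_neqAle nab.
have fab : f b < f a.
  rewrite /f -(opprB 2 q) !powRN ltf_pV2 ?posrE ?powR_gt0//.
  by rewrite gt0_ltr_powR ?nnegrE ?subr_gt0// ltW.
have P : 0 < (f a - f b) * ((b - a) * (b + a)).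
  by rewrite mulr_gt0 ?subr_gt0// mulr_gt0 ?subr_gt0// addr_gt0.
by split; [exact: ltW|move=> E; move: P; rewrite E ltxx].
Qed.

(** The two Picone inequalities bound the integral of the gap of
    [sublinear_gap] from above by 0.  Where one function vanishes so does the
    other, by [strong_maximum]. *)
Lemma supersolution_unique z b : supersolution z -> supersolution b ->
  (\int[leb]_x (z x)%:E != 0)%E -> (\int[leb]_x (b x)%:E != 0)%E ->
  {ae leb, forall x, z x = b x}.
Proof.
move=> sz sb zn0 bn0; have [[az z0 _ zz] [ab b0 _ bb]] := (sz, sb).
have [mz mb] := (approximable_measurable az, approximable_measurable ab).
have aezb := strong_maximum sz ab b0 zn0.
have aebz := strong_maximum sb az z0 bn0.
have [iz ib] := (integrable_lq az z0, integrable_lq ab b0).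
have mv w : measurable_fun setT w -> (forall x, 0 <= w x) ->
    measurable_fun setT (fun x => (w x)^-1).
  move=> mw w0; rewrite (_ : (fun x => _) = (fun x => w x `^ (-1))).
    exact: measurable_powR_comp.
  by apply/funext => x; rewrite powR_inv1.
have mP w w' : measurable_fun setT w -> (forall x, 0 <= w x) ->
    measurable_fun setT w' ->
    measurable_fun setT (fun x => w x `^ (q - 1) * (w' x ^+ 2 / w x)).
  move=> mw w0 mw'; apply: measurable_funM; first exact: measurable_powR_comp.
  by apply: measurable_funM; [exact: measurable_funX|exact: mv].
have P0 (w w' : V -> R) x : (forall x, 0 <= w x) ->
    0 <= w x `^ (q - 1) * (w' x ^+ 2 / w x).
  by move=> w0; rewrite mulr_ge0 ?powR_ge0// divr_ge0// sqr_ge0.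
have [pz pb] := (picone sz ab, picone sb az).
have i1 := int_real_lty (mP _ _ mz z0 mb) (fun x => P0 z b x z0)
  (le_lt_trans pz (ltry _)).
have i2 := int_real_lty (mP _ _ mb b0 mz) (fun x => P0 b z x b0)
  (le_lt_trans pb (ltry _)).
rewrite (Rintegral_EFin i1) lee_fin in pz;
  rewrite (Rintegral_EFin i2) lee_fin in pb.
pose D x := z x `^ (q - 1) * (b x ^+ 2 / z x) + b x `^ (q - 1) * (z x ^+ 2 / b
  x) -
    (z x `^ q + b x `^ q).
have iD : leb.-integrable setT (EFin \o D).
  exact: (integrableB measurableT (integrableD measurableT i1 i2)
    (integrableD measurableT iz ib)).
have D_le0 : \int[leb]_x D x <= 0.
  rewrite /D RintegralB//; last 2 first.
  - exact: (integrableD measurableT i1 i2).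
  - exact: (integrableD measurableT iz ib).
  rewrite (RintegralD measurableT i1 i2) (RintegralD measurableT iz ib).
  rewrite subr_le0 addrC; apply: lerD; first exact: (le_trans pb zz).
  exact: (le_trans pz bb).
have aeD : {ae leb, forall x, 0 <= D x /\ (D x = 0 -> z x = b x)}.
  apply: filterS2 aezb aebz => x zb bz.
  have [zx|zx] := eqVneq (z x) 0.
    by rewrite /D zx (zb zx) powR0 ?gt_eqF// !mul0r powR0 ?gt_eqF// addr0 subrr.
  have [bx|bx] := eqVneq (b x) 0; first by rewrite (bz bx) eqxx in zx.
  by apply: sublinear_gap; rewrite lt_neqAle eq_sym ?zx ?bx ?z0 ?b0.
have mD : measurable_fun setT D by apply/measurable_EFinP; case/integrableP: iD.
have : (\int[leb]_x `|D x|%:E = 0)%E.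
  apply/eqP; rewrite eq_le; apply/andP; split; last first.
    by apply: integral_ge0 => x _; rewrite lee_fin.
  rewrite (_ : (\int[leb]_x `|D x|%:E = \int[leb]_x (D x)%:E)%E).
    by rewrite (Rintegral_EFin iD) lee_fin.
  apply: ae_eq_integral => //.
  - by apply/measurable_EFinP; exact: measurableT_comp.
  - exact/measurable_EFinP.
  - by apply: filterS aeD => x [D0 _] _; rewrite ger0_norm.
move=> /(ge0_int0_ae (measurableT_comp (@normr_measurable _ setT) mD)
  (fun x => normr_ge0 (D x))) aeD0.
apply: filterS2 aeD aeD0 => x [_ DE] /eqP; rewrite normr_eq0 => /eqP.
exact: DE.
Qed.

End supersolutions.

(** * Critical points and minimisers *)

Section critical_points_and_minimisers.
Context {R : realType} {N : nat}.
Variables (s q : R) (Omega : set 'rV[R]_N).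
Hypothesis q1 : 1 < q.
Hypotheses (oOmega : open Omega) (bOmega : bounded_set Omega).
Let q0 : 0 < q := lt_trans ltr01 q1.
Let qm0 : 0 < q - 1. Proof. by rewrite subr_gt0. Qed.
Local Notation V := ('rV[R]_N).
Local Notation leb := (@lebesgue_rV R N).
Implicit Types u v w f g h z b phi m : V -> R.
Local Notation approximable := (approximable s q Omega).
Local Notation supersolution := (supersolution s q Omega).
Local Notation dotG := (dotG s).
Local Notation gsq := (gagliardo_sq s).
Let mOmega : measurable Omega := measurable_Omega oOmega.

(* the properties of the energy space with the standing hypotheses supplied *)
Let aF u (a : approximable u) : finite_energy s u := approximable_finite q1 a.
Let aZ c u (a : approximable u) : approximable (c \*o u) :=
  approximable_scale q1 oOmega bOmega c a.
Let aD u v (a : approximable u) (b : approximable v) : approximable (u \+ v) :=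
  approximable_add q1 oOmega bOmega a b.
Let anorm u (a : approximable u) : approximable (fun x => `|u x|) :=
  approximable_norm q1 oOmega bOmega a.
Let aM u (a : approximable u) : measurable_fun setT u :=
  approximable_measurable a.
Let aO u (a : approximable u) : forall x, ~ Omega x -> u x = 0.
Proof. by case: a. Qed.

Lemma integrable_L1 u : approximable u -> leb.-integrable setT (EFin \o u).
Proof.
move=> au; have iq := approximable_lq q1 oOmega bOmega au.
have i1 : leb.-integrable setT (EFin \o (fun x => 1 * \1_Omega x : R)).
  apply: int_real_lty => //.
    exact: measurable_funM.
  by rewrite int_indic_Omega// ltry.
apply: le_integrable (integrableD measurableT i1 iq) => //.
  by apply/measurable_EFinP; exact: aM.
move=> x _ /=; rewrite lee_fin mul1r [leRHS]ger0_norm; last first.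
  by rewrite addr_ge0// powR_ge0.
have [Ox|nOx] := pselect (Omega x); last first.
  by rewrite (aO au nOx) normr0 addr_ge0// powR_ge0.
rewrite indicE mem_set//; have [u1|/ltW u1] := leP `|u x| 1.
  by rewrite -[leLHS]addr0 lerD// powR_ge0.
by rewrite ler_wpDl// le1r_powR// ltW.
Qed.

Lemma critical_source_self (x : R) : `|x| `^ (q - 2) * x * x = `|x| `^ q.
Proof.
have [->|x0] := eqVneq x 0; first by rewrite mulr0 normr0 powR0// gt_eqF.
rewrite -mulrA -expr2 -real_normK ?num_real// -powR_mulrn//.
by rewrite -powRD ?subrK// normr_eq0 x0 implybT.
Qed.

(** Tested with itself, the equation says that the energy equals the finite
    integral of [|u|^q]. *)
Lemma critical_approximable u : critical_point s q Omega u -> approximable u.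
Proof.
move=> [Du uE]; apply: D0s2_approximable => //.
rewrite (_ : gsq u = gagliardo_form s u u); last first.
  by apply: eq_integral => y _; rewrite expr2.
rewrite (uE _ Du).
rewrite (integral_Omega (F := fun x => `|u x| `^ (q - 2) * u x * u x));
  last first.
  by move=> x nx; have [_ -> //] := Du; rewrite mulr0.
under eq_integral do rewrite critical_source_self.
exact: D0s2_lq_finite Du.
Qed.

Lemma integrable_critical u phi : approximable u -> approximable phi ->
  leb.-integrable setT (EFin \o (fun x => `|u x| `^ (q - 2) * u x * phi x)).
Proof.
move=> au ap; have iq := integrable_source q1 oOmega bOmega au ap.
apply: le_integrable iq => //.
  apply/measurable_EFinP; apply: measurable_funM; last exact: aM.
  apply: measurable_funM; last exact: aM.
  by apply: measurable_powR_comp; exact: measurableT_comp (aM au).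
move=> x _ /=; rewrite lee_fin !normrM; apply: ler_wpM2r => //.
rewrite (ger0_norm (powR_ge0 _ (q - 2))) (ger0_norm (powR_ge0 _ (q - 1))).
have -> : q - 2 = q - 1 - 1 by ring.
by rewrite mulrC mulr_powRB1.
Qed.

Lemma critical_weak u phi : critical_point s q Omega u -> approximable phi ->
  dotG u phi = \int[leb]_x (`|u x| `^ (q - 2) * u x * phi x).
Proof.
move=> cu ap; have au := critical_approximable cu; have [_ uE] := cu.
apply: EFin_inj; rewrite -gagliardo_form_dotG//; [|exact: aF..].
rewrite uE; last exact: approximable_D0s2.
rewrite (integral_Omega (F := fun x => `|u x| `^ (q - 2) * u x * phi x)).
  by rewrite Rintegral_EFin//; exact: integrable_critical.
by move=> x nx; rewrite (aO ap nx) mulr0.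
Qed.

Lemma critical_energy u : critical_point s q Omega u ->
  dotG u u = \int[leb]_x (`|u x| `^ q).
Proof.
move=> cu; rewrite (critical_weak cu (critical_approximable cu)).
by apply: eq_Rintegral => x _; rewrite critical_source_self.
Qed.

Lemma dotG_norm_le u : approximable u ->
  dotG (fun x => `|u x|) (fun x => `|u x|) <= dotG u u.
Proof.
move=> au; have f0 := aF (approximable0 s Omega q1).
have := @dotG_le_add _ _ s _ _ _ (aF (anorm au)) (aF au) f0 _.
have -> : dotG (cst 0 : V -> R) (cst 0 : V -> R) = 0.
  rewrite /dotG /wdot /Rintegral integral0_eq//= => y _.
  by rewrite /increment subrr !mul0r.
rewrite addr0; apply => y.
by have := increment_hypot u (cst 0) y; rewrite hypot0.
Qed.

Lemma dotG_eq0 m phi : finite_energy s m -> finite_energy s phi ->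
  dotG m m = 0 -> dotG m phi = 0.
Proof.
move=> fm fp m0.
have Y c : 2 * (c * dotG m phi) <= dotG phi phi.
  have := dotG_young (finite_energyZ c fm) fp.
  rewrite !dotGZl// ?dotGZr//; last exact: finite_energyZ.
  by rewrite m0 !mulr0 add0r.
apply/eqP; apply: contrapT => /negP d0.
have := Y ((dotG phi phi + 1) / dotG m phi); rewrite divfK//.
have := dotG_ge0 s phi; lra.
Qed.

Definition energy phi : R :=
  2^-1 * dotG phi phi - q^-1 * \int[leb]_x (phi x `^ q).

Lemma int_Omega_powR phi : (forall x, ~ Omega x -> phi x = 0) ->
  (\int[leb]_(x in Omega) (phi x `^ q)%:E = \int[leb]_x (phi x `^ q)%:E)%E.
Proof.
move=> p0; apply: (integral_Omega (F := fun x => phi x `^ q)) => x nx.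
by rewrite p0// powR0// gt_eqF.
Qed.

Lemma lane_emden_energyE phi : approximable phi -> (forall x, 0 <= phi x) ->
  lane_emden_energy s q Omega phi = (energy phi)%:E.
Proof.
move=> ap p0; rewrite /lane_emden_energy dotGE; last exact: aF.
rewrite int_Omega_powR; last exact: aO.
by rewrite (Rintegral_EFin (integrable_lq q1 oOmega bOmega ap p0)).
Qed.

Lemma admissible_nonneg phi : approximable phi -> (forall x, 0 <= phi x) ->
  lane_emden_admissible s q Omega phi.
Proof. by move=> ap p0; split; [exact: approximable_D0s2|exact: aeW]. Qed.

Lemma density_ae_norm w : D0s2 s q Omega w ->
  {ae leb, forall x, Omega x -> 0 <= w x} ->
  {ae leb, forall x, w x = `|w x|}.
Proof.
move=> [_ w0 _]; apply: filterS => x wx.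
have [/wx w1|/w0 ->] := pselect (Omega x); last by rewrite normr0.
by rewrite ger0_norm.
Qed.

(** The functional is at most 0, its value at the zero function, and its
    lower-order term is finite. *)
Lemma density_approximable w : lane_emden_density s q Omega w ->
  approximable w.
Proof.
move=> [[Dw wpos] wmin]; apply: D0s2_approximable => //.
have a0 := approximable0 s Omega q1.
have := wmin _ (admissible_nonneg a0 (fun=> lexx 0)).
have [mw w0 _] := Dw.
have wq : (\int[leb]_(x in Omega) (w x `^ q)%:E < +oo)%E.
  rewrite int_Omega_powR// (ae_eq_integral (fun x => (`|w x| `^ q)%:E))//.
  - exact: D0s2_lq_finite Dw.
  - by apply/measurable_EFinP; exact: measurable_powR_comp.
  - by apply/measurable_EFinP; exact: measurable_powR_norm.
  - by apply: filterS (density_ae_norm Dw wpos) => x {1}-> _.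
have wq0 : (0 <= \int[leb]_(x in Omega) (w x `^ q)%:E)%E.
  by apply: integral_ge0 => x _; rewrite lee_fin powR_ge0.
rewrite (lane_emden_energyE a0 (fun=> lexx 0)) => Ew.
rewrite ltey; apply/eqP => gw; move: Ew; rewrite /lane_emden_energy gw.
rewrite mulry gtr0_sg ?invr_gt0// mul1e.
have /fineK <- : (\int[leb]_(x in Omega) (w x `^ q)%:E)%E \is a fin_num.
  by rewrite ge0_fin_numE.
by [].
Qed.

(** A density is only nonnegative almost everywhere; its absolute value is
    nonnegative everywhere and still minimises. *)
Lemma density_norm_min w : lane_emden_density s q Omega w ->
  forall phi, approximable phi -> (forall x, 0 <= phi x) ->
  energy (fun x => `|w x|) <= energy phi.
Proof.
move=> dw phi ap p0; have aw := density_approximable dw.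
have [[Dw wpos] wmin] := dw.
rewrite -lee_fin -(lane_emden_energyE ap p0).
apply: le_trans (wmin _ (admissible_nonneg ap p0)).
rewrite /lane_emden_energy dotGE; last exact: aF.
rewrite int_Omega_powR; last exact: aO.
rewrite (ae_eq_integral (fun x => (`|w x| `^ q)%:E))//; last 3 first.
- by apply/measurable_EFinP; apply: measurable_powR_comp; exact: aM.
- by apply/measurable_EFinP; apply: measurable_powR_norm; exact: aM.
- by apply: filterS (density_ae_norm Dw wpos) => x {1}-> _.
rewrite (Rintegral_EFin (approximable_lq q1 oOmega bOmega aw)).
rewrite /energy -!EFinM -EFinB lee_fin lerD2r ler_wpM2l//.
exact: dotG_norm_le.
Qed.

(** The inequality for [phi] is the comparison of [z] with [z + t phi], using
    convexity of the power, as [t] tends to 0.  For the last condition put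
    [A = E(z)] and [B = int z^q]: if [B < A], then [(B / A) z] has smaller energy. *)
Lemma minimiser_supersolution z : approximable z -> (forall x, 0 <= z x) ->
  (forall phi, approximable phi -> (forall x, 0 <= phi x) ->
    energy z <= energy phi) -> supersolution z.
Proof.
move=> az z0 zmin; split => //.
- move=> phi ap p0.
  have key t : 0 < t -> \int[leb]_x (z x `^ (q - 1) * phi x) <=
      dotG z phi + t / 2 * dotG phi phi.
    move=> t0; have atp := aZ t ap; have az' := aD az atp.
    have z'0 x : 0 <= (z \+ (t \*o phi)) x by rewrite addr_ge0// mulr_ge0// ltW.
    have := zmin _ az' z'0; rewrite /energy.
    have [[fz fp] ftp] := (aF az, aF ap, aF atp).
    rewrite dotGDl// ?dotGDr//; last exact: aF.
    rewrite !dotGZl// !dotGZr// (dotGC s phi z).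
    have iz := integrable_lq q1 oOmega bOmega az z0.
    have iz' := integrable_lq q1 oOmega bOmega az' z'0.
    have ip := integrable_source_ge0 q1 oOmega bOmega az z0 ap.
    have ipt : leb.-integrable setT
        (EFin \o (fun x => q * t * (z x `^ (q - 1) * phi x))).
      exact: (integrableZl measurableT (q * t) ip).
    have : \int[leb]_x (z x `^ q) + q * t * \int[leb]_x (z x `^ (q - 1) * phi
      x) <=
        \int[leb]_x ((z \+ (t \*o phi)) x `^ q).
      rewrite -RintegralZl// -RintegralD//.
      apply: le_Rintegral => //; first exact: (integrableD measurableT iz ipt).
      move=> x _; have := powR_tangent q1 (z'0 x) (z0 x).
      rewrite /= [_ - z x]addrC addKr; apply: le_trans.
      by rewrite lerD2l le_eqVlt; apply/orP; left; apply/eqP; ring.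
    move: (\int[leb]_x _) (\int[leb]_x _) (\int[leb]_x _) => a b c abc.
    move: (dotG z z) (dotG z phi) (dotG phi phi) => d e f.
    have qV0 : 0 < q^-1 by rewrite invr_gt0.
    have : q^-1 * (c + q * t * b) <= q^-1 * a.
      by apply: ler_wpM2l => //; exact: ltW.
    rewrite mulrDr -mulrA mulKf ?gt_eqF// => h1 h2.
    rewrite -(ler_pM2l t0) mulrDr; lra.
  apply/ler_addgt0Pr => e e0.
  have p00 := dotG_ge0 s phi.
  have p1 : 0 < dotG phi phi + 1 by lra.
  have t0 : 0 < 2 * e / (dotG phi phi + 1) by rewrite divr_gt0// mulr_gt0.
  apply: le_trans (key _ t0) _; rewrite lerD2l.
  move: (dotG phi phi) p1 p00 {t0} => d d1 d0.
  have -> : 2 * e / (d + 1) / 2 * d = e * (d / (d + 1)) by field;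
    rewrite gt_eqF.
  by rewrite -[leRHS]mulr1 ler_wpM2l ?(ltW e0)// ler_pdivrMr// mul1r lerDl.
- set A := dotG z z; set B := \int[leb]_x _.
  have B0 : 0 <= B by apply: Rintegral_ge0 => x _; exact: powR_ge0.
  rewrite leNgt; apply/negP => BA.
  have A0 : 0 < A by exact: le_lt_trans BA.
  have t0 : 0 <= B / A by rewrite divr_ge0// ltW.
  have tz0 x : 0 <= ((B / A) \*o z) x by rewrite mulr_ge0.
  have := zmin _ (aZ (B / A) az) tz0; rewrite /energy.
  have fz := aF az.
  rewrite dotGZl// ?dotGZr//; last exact: finite_energyZ.
  rewrite (_ : \int[leb]_x ((B / A \*o z) x `^ q) = (B / A) `^ q * B);
    last first.
    rewrite -RintegralZl//; last exact: (integrable_lq q1 oOmega bOmega az z0).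
    by apply: eq_Rintegral => x _; rewrite /= powRM.
  rewrite -/A -/B mulrA -expr2.
  have := powR_tangent q1 t0 ler01; rewrite !powR1 mul1r.
  have : B / A < 1 by rewrite ltr_pdivrMr// mul1r.
  have EB : B = B / A * A by rewrite divfK// gt_eqF.
  move: (B / A) EB t0 B0 => t -> t0 B0; move: (t `^ q) => T t1 hT.
  have qV0 : 0 < q^-1 by rewrite invr_gt0.
  have : q^-1 * (1 + q * (t - 1)) <= q^-1 * T.
    by apply: ler_wpM2l => //; exact: ltW.
  rewrite mulrDr mulrA mulVf ?gt_eqF// mul1r mulr1 => h1.
  have h2 := ler_wpM2l B0 h1.
  have h3 : 0 < A * (1 - t) ^+ 2 by rewrite mulr_gt0// exprn_gt0// subr_gt0.
  move: h2 h3; move: (q^-1) => r; nra.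
Qed.

End critical_points_and_minimisers.

(** * Functions of small mass *)

Section kernel_bounds.
Context {R : realType} {N : nat}.
Variable s : R.
Hypothesis s0 : 0 < s.
Local Notation V := ('rV[R]_N).

Lemma euclidean_norm_le (x : V) (r : R) : (forall i, `|x ord0 i| <= r) ->
  0 <= r -> euclidean_norm x <= Num.sqrt N%:R * r.
Proof.
move=> xr rr; rewrite -(ger0_norm rr) -sqrtr_sqr -sqrtrM//.
apply: ler_wsqrtr; rewrite mulr_natl -[X in _ *+ X]card_ord -sumr_const.
apply: ler_sum => i _; rewrite -real_normK ?num_real//.
by rewrite ler_pXn2r ?nnegrE.
Qed.

Lemma riesz_ge (z : V * V) (r : R) : (forall i, `|z.1 ord0 i - z.2 ord0 i| <=
  r) ->
  0 <= r -> z.1 != z.2 ->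
  ((Num.sqrt N%:R * r) `^ (N%:R + 2 * s))^-1 <= riesz s z.
Proof.
move=> zr rr z12.
have e0 := riesz_gt0 s z12; rewrite invr_gt0 in e0.
have el : euclidean_norm (z.1 - z.2) <= Num.sqrt N%:R * r.
  by apply: euclidean_norm_le => // i; rewrite !mxE.
have Ns0 : 0 <= N%:R + 2 * s by rewrite addr_ge0// mulr_ge0// ltW.
have le : euclidean_norm (z.1 - z.2) `^ (N%:R + 2 * s) <=
    (Num.sqrt N%:R * r) `^ (N%:R + 2 * s).
  by rewrite ge0_ler_powR ?nnegrE ?sqrtr_ge0// mulr_ge0 ?sqrtr_ge0.
by rewrite /riesz lef_pV2 ?posrE//; exact: lt_le_trans le.
Qed.

End kernel_bounds.

Section small_mass.
Context {R : realType} {N : nat}.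
Variables (s q : R) (Omega : set 'rV[R]_N).
Hypotheses (N1 : (1 <= N)%N) (s0 : 0 < s) (q1 : 1 < q) (q2 : q < 2).
Hypotheses (oOmega : open Omega) (bOmega : bounded_set Omega).
Let q0 : 0 < q := lt_trans ltr01 q1.
Let qm0 : 0 < q - 1. Proof. by rewrite subr_gt0. Qed.
Local Notation V := ('rV[R]_N).
Local Notation leb := (@lebesgue_rV R N).
Implicit Types u v w m : V -> R.
Local Notation approximable := (approximable s q Omega).
Local Notation dotG := (dotG s).
Let mr := @measurable_riesz R N s.
Let r0 := @riesz_ge0 R N s.
Let sN0 : 0 < Num.sqrt N%:R :> R. Proof. by rewrite sqrtr_gt0 ltr0n. Qed.

(** The right-hand side is a positive multiple of [r ^ (- 2 s)]. *)
Lemma radius_exists (kappa : R) : 0 < kappa -> exists2 r : R, 0 < r &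
  kappa <= ((Num.sqrt N%:R * r) `^ (N%:R + 2 * s))^-1 * r ^+ N.
Proof.
move=> k0; pose A := (Num.sqrt N%:R `^ (N%:R + 2 * s))^-1 : R.
have A0 : 0 < A by rewrite invr_gt0 powR_gt0.
have kA : 0 < kappa / A by rewrite divr_gt0.
exists ((kappa / A) `^ (- (2 * s)^-1)); first exact: powR_gt0.
set r := _ `^ (- _); have rr : 0 < r by exact: powR_gt0.
rewrite powRM ?(ltW rr) ?(ltW sN0)// invfM -/A -powR_mulrn ?(ltW rr)//.
rewrite -powRN -mulrA -powRD; last by rewrite (gt_eqF rr) implybT.
rewrite (_ : - (N%:R + 2 * s) + N%:R = - (2 * s)); last by ring.
rewrite /r -powRrM mulrNN mulVf ?gt_eqF ?mulr_gt0// powRr1 ?(ltW kA)//.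
by rewrite mulrC divfK// gt_eqF.
Qed.

Lemma markov_real m (eta : R) : measurable_fun setT m -> (forall x, 0 <= m x) ->
  0 < eta -> leb.-integrable setT (EFin \o m) ->
  (leb [set x | (eta <= m x)%R] <= ((\int[leb]_x m x) / eta)%:E)%E.
Proof.
move=> mm m0 e0 im.
have mE : measurable [set x | eta <= m x].
  rewrite (_ : [set x | _] = m @^-1` `[eta, +oo[%classic); last first.
    by apply/seteqP; split => x /=; rewrite in_itv /= andbT.
  by rewrite -[X in measurable X]setTI; exact: mm.
rewrite mulrC EFinM -Rintegral_EFin// -lee_pdivrMl ?invr_gt0// invrK.
rewrite -[X in leb X]setIT -integral_indic// -ge0_integralZl//; last 2 first.
- exact/measurable_EFinP.
- by rewrite lee_fin ltW.
under eq_integral do rewrite -EFinM.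
apply: le_int_real => //.
- exact: measurable_funM.
- by move=> x; rewrite mulr_ge0// ltW.
- move=> x; rewrite indicE; case: (boolP (x \in _)) => [|_].
    by rewrite inE mulr1.
  by rewrite mulr0.
Qed.

(** By Markov's inequality the set [E] where [m >= eta / 2] covers at most
    half of the cube of side [2 r] around [x]; on the rest of the cube
    [m(x) - m(y) >= m(x) / 2] and the kernel is at least its value at the
    corners. *)
Lemma nonlocal_lower_bound m (eta r : R) : approximable m ->
  (forall x, 0 <= m x) -> 0 < eta -> 0 < r ->
  \int[leb]_x m x <= eta * r ^+ N / 2 ->
  forall x, eta < m x ->
  ((m x ^+ 2 / 4 * (((Num.sqrt N%:R * r) `^ (N%:R + 2 * s))^-1 * r ^+ N))%:E <=
   \int[leb]_y (increment m (x, y) ^+ 2 * riesz s (x, y))%:E)%E.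
Proof.
move=> am m0 e0 rr Im x mx.
have mm := approximable_measurable am.
have im := integrable_L1 q1 oOmega bOmega am.
set E := [set y | eta / 2 <= m y].
set Q := [set y : V | forall i, `|x ord0 i - y ord0 i| <= r].
have e20 : 0 < eta / 2 by rewrite divr_gt0.
have mE : measurable E.
  rewrite /E (_ : [set y | _] = m @^-1` `[eta / 2, +oo[%classic); last first.
    by apply/seteqP; split => y /=; rewrite in_itv /= andbT.
  by rewrite -[X in measurable X]setTI; exact: mm.
have mQ : measurable Q by exact: measurable_cube.
have mQE : measurable (Q `\` E) by exact: measurableD.
have leE : (leb E <= (r ^+ N)%:E)%E.
  apply: le_trans (markov_real mm m0 e20 im) _.
  by rewrite lee_fin ler_pdivrMr// mulrC mulrAC.
have leQ : (leb Q = ((2 * r) ^+ N)%:E)%E by rewrite cube_measure// ltW.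
have geQE : ((r ^+ N)%:E <= leb (Q `\` E))%E.
  have h : (leb Q <= leb (Q `\` E) + leb E)%E.
    apply: le_trans (measureU2 _ mQE mE); apply: le_measure; rewrite ?inE//.
      exact: measurableU.
    by move=> y Qy; have [Ey|nEy] := pselect (E y); [right|left].
  have rN0 : 0 < r ^+ N by rewrite exprn_gt0.
  have : ((2 * r ^+ N)%:E <= leb (Q `\` E) + (r ^+ N)%:E)%E.
    apply: (@le_trans _ _ (leb Q)).
      rewrite leQ lee_fin exprMn ler_wpM2r ?(ltW rN0)//.
      by rewrite -[leLHS]expr1 ler_weXn2l// ler1n.
    by apply: le_trans h _; rewrite leeD2l.
  by rewrite mulrDl mul1r EFinD leeD2rE.
set k := (_ `^ _)^-1.
have k0 : 0 <= k by rewrite invr_ge0 powR_ge0.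
have c0 : 0 <= m x ^+ 2 / 4 * k by rewrite mulr_ge0// divr_ge0// sqr_ge0.
apply: (@le_trans _ _ ((m x ^+ 2 / 4 * k)%:E * leb (Q `\` E))%E).
  by rewrite mulrA EFinM lee_wpmul2l.
rewrite -[X in leb X]setIT -integral_indic// -ge0_integralZl//;
  last exact/measurable_EFinP.
under eq_integral do rewrite -EFinM.
apply: le_int_real => //.
- exact: measurable_funM.
- apply: (measurableT_comp (measurable_wsq mr (measurable_increment mm))).
  exact: measurable_pair1.
- by move=> y; rewrite mulr_ge0.
- move=> y; rewrite indicE; case: (boolP (y \in _)) => [|_]; last first.
    by rewrite mulr0; exact: (wsq_ge0 r0 (increment m)).
  rewrite inE mulr1 => -[Qy /negP]; rewrite -ltNge => my.
  have xy : x != y by apply: contraTneq my => <-; rewrite -leNgt; lra.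
  have kr := @riesz_ge _ _ s s0 (x, y) r Qy (ltW rr) xy.
  apply: ler_pM => //; first by rewrite divr_ge0// sqr_ge0.
  rewrite /increment /=.
  have my0 := m0 y; move: (m x) (m y) my my0 mx => a b; nra.
Qed.

(** The threshold [eta] makes [m^q <= (c / 2) m] below it.  Above it,
    [m^q <= eta^(q-2) m^2], and [nonlocal_lower_bound] with a radius given by
    [radius_exists] bounds twice its integral by [E(m)].  Half of each term on
    the left of the hypothesis is left over. *)
Lemma small_mass (c : R) : 0 < c -> exists2 delta : R, 0 < delta &
  forall m, approximable m -> (forall x, 0 <= m x) ->
    \int[leb]_x m x <= delta ->
    dotG m m + c * \int[leb]_x m x <= \int[leb]_x (m x `^ q) ->
    dotG m m = 0 /\ \int[leb]_x m x = 0.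
Proof.
move=> c0; pose eta : R := (c / 2) `^ (q - 1)^-1.
have c20 : 0 < c / 2 by rewrite divr_gt0.
have e0 : 0 < eta by exact: powR_gt0.
have etaE : eta `^ (q - 1) = c / 2.
  by rewrite /eta -powRrM mulVf ?gt_eqF// powRr1// ltW.
have k0 : 0 < 8 * eta `^ (q - 2) by rewrite mulr_gt0// powR_gt0.
have [r rr rk] := radius_exists k0.
exists (eta * r ^+ N / 2); first by rewrite divr_gt0// mulr_gt0// exprn_gt0.
move=> m am m0 Im hm.
have mm := approximable_measurable am.
have fm := approximable_finite q1 am.
have im := integrable_L1 q1 oOmega bOmega am.
have iq := integrable_lq q1 oOmega bOmega am m0.
pose S := [set x | eta < m x].
have mS : measurable S.
  rewrite /S (_ : [set y | _] = m @^-1` `]eta, +oo[%classic); last first.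
    by apply/seteqP; split => y /=; rewrite in_itv /= andbT.
  by rewrite -[X in measurable X]setTI; exact: mm.
pose G x := m x `^ q * \1_S x.
have mq : measurable_fun setT (fun x => m x `^ q) by exact:
  measurable_powR_comp.
have mG : measurable_fun setT G by exact: measurable_funM.
have G0 x : 0 <= G x by rewrite mulr_ge0// powR_ge0.
have iG : leb.-integrable setT (EFin \o G).
  apply: le_integrable iq => //; first exact/measurable_EFinP.
  move=> x _; rewrite /= lee_fin !ger0_norm ?powR_ge0// /G.
  by rewrite ler_piMr ?powR_ge0// indicE; case: (_ \in _); rewrite ?ler01.
have GE : 2 * \int[leb]_x G x <= dotG m m.
  rewrite -lee_fin EFinM -Rintegral_EFin// -dotGE// gagliardo_sqE.
  have mF : measurable_fun setT
      (fun z : V * V => (increment m z ^+ 2 * riesz s z)%:E).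
    apply/measurable_EFinP; apply: measurable_wsq => //.
    exact: measurable_increment.
  have F0 z : (0 <= (increment m z ^+ 2 * riesz s z)%:E)%E.
    by rewrite lee_fin; exact: (wsq_ge0 r0 (increment m)).
  rewrite fubini_tonelli1// -ge0_integralZl//; last 2 first.
  - exact/measurable_EFinP.
  - by move=> x _; rewrite lee_fin.
  apply: ge0_le_integral => //.
  - by move=> x _; rewrite -EFinM lee_fin mulr_ge0.
  - by apply: measurable_funeM; exact/measurable_EFinP.
  - exact: measurable_fun_fubini_tonelli_F.
  move=> x _; rewrite /G indicE; case: (boolP (x \in S)) => [|_]; last first.
    by rewrite mulr0 mule0; apply: integral_ge0 => y _; exact: F0.
  rewrite inE mulr1 => Sx.
  apply: le_trans (nonlocal_lower_bound am m0 e0 rr Im Sx).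
  rewrite -EFinM lee_fin.
  apply: (@le_trans _ _ (m x ^+ 2 / 4 * (8 * eta `^ (q - 2)))); last first.
    by rewrite ler_wpM2l// divr_ge0// sqr_ge0.
  have mx0 : 0 < m x := lt_trans e0 Sx.
  have -> : m x `^ q = m x ^+ 2 * m x `^ (q - 2).
    rewrite -powR_mulrn// -powRD; last by rewrite (gt_eqF mx0) implybT.
    by congr (_ `^ _); ring.
  have : m x `^ (q - 2) <= eta `^ (q - 2).
    rewrite -(opprB 2 q) !powRN lef_pV2 ?posrE ?powR_gt0//.
    by rewrite ge0_ler_powR ?nnegrE ?subr_ge0 ?(ltW q2) ?(ltW e0)// ltW.
  have := sqr_ge0 (m x); move: (m x ^+ 2) (m x `^ _) (eta `^ _) => a b d; nra.
have : \int[leb]_x (m x `^ q) <= \int[leb]_x (c / 2 * m x + G x).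
  have icm : leb.-integrable setT (EFin \o (fun x => c / 2 * m x)).
    exact: (integrableZl measurableT (c / 2) im).
  apply: le_Rintegral => //; first exact: (integrableD measurableT icm iG).
  move=> x _; rewrite /G indicE; case: (boolP (x \in S)) => [_|].
    by rewrite mulr1 lerDr mulr_ge0// ltW.
  rewrite notin_setE /S /= => /negP; rewrite -leNgt => mx.
  rewrite mulr0 addr0 -(mulr_powRB1 (m0 x) q0) mulrC ler_wpM2r// -etaE.
  by rewrite ge0_ler_powR ?nnegrE ?(ltW qm0)// (ltW e0).
rewrite RintegralD//; last exact: (integrableZl measurableT (c / 2) im).
rewrite RintegralZl//.
have M0 : 0 <= \int[leb]_x m x by apply: Rintegral_ge0.
have D0 := dotG_ge0 s m.
move: (\int[leb]_x m x) M0 hm GE => M M0 hm GE hI.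
have cM : 0 <= c * M by rewrite mulr_ge0// ltW.
have d0 : dotG m m = 0 by lra.
split=> //; have cM0 : c * M = 0 by lra.
by move/eqP: cM0; rewrite mulf_eq0 gt_eqF//= => /eqP.
Qed.

End small_mass.

(** * Isolation of the density *)

Section isolation.
Context {R : realType} {N : nat}.
Variables (s q : R) (Omega : set 'rV[R]_N).
Hypotheses (N1 : (1 <= N)%N) (s0 : 0 < s) (q1 : 1 < q) (q2 : q < 2).
Hypotheses (oOmega : open Omega) (bOmega : bounded_set Omega).
Let q0 : 0 < q := lt_trans ltr01 q1.
Local Notation V := ('rV[R]_N).
Local Notation leb := (@lebesgue_rV R N).
Implicit Types u v w z m : V -> R.
Local Notation approximable := (approximable s q Omega).
Local Notation supersolution := (supersolution s q Omega).
Local Notation dotG := (dotG s).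
Let mr := @measurable_riesz R N s.

(* the properties of the energy space with the standing hypotheses supplied *)
Let aF u (a : approximable u) : finite_energy s u := approximable_finite q1 a.
Let apos u (a : approximable u) : approximable (pos u) :=
  approximable_pos q1 oOmega bOmega a.
Let aneg u (a : approximable u) : approximable (neg u) :=
  approximable_neg q1 oOmega bOmega a.
Let anorm u (a : approximable u) : approximable (fun x => `|u x|) :=
  approximable_norm q1 oOmega bOmega a.
Let aB u v (a : approximable u) (b : approximable v) : approximable (u \- v) :=
  approximable_sub q1 oOmega bOmega a b.
Let aM u (a : approximable u) : measurable_fun setT u :=
  approximable_measurable a.
Let L1 u (a : approximable u) : leb.-integrable setT (EFin \o u) :=
  integrable_L1 q1 oOmega bOmega a.

(** Both functions live in the bounded set [Omega], on which the kernel is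
    bounded below. *)
Lemma interaction_lower_bound : exists2 c : R, 0 < c &
  forall u v, approximable u -> approximable v ->
    (forall x, 0 <= u x) -> (forall x, 0 <= v x) -> (forall x, u x * v x = 0) ->
    c * (\int[leb]_x u x * \int[leb]_x v x) <= - dotG u v.
Proof.
have [M M0 OM] := bounded_set_cube bOmega.
pose k : R := ((Num.sqrt N%:R * (2 * M)) `^ (N%:R + 2 * s))^-1.
have k0 : 0 < k.
  by rewrite invr_gt0 powR_gt0// !mulr_gt0// sqrtr_gt0 ltr0n.
exists k; first exact: k0.
move=> u v au av u0 v0 uv.
have [[mu uO _] [mv vO _]] := (au, av).
rewrite -lee_fin.
apply: le_trans (cross_term (aF au) (aF av) mu mv u0 v0 uv).
rewrite EFinM EFinM -!Rintegral_EFin; [|exact: L1..].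
rewrite -integral_tensor// -ge0_integralZl//; last 3 first.
- by apply/measurable_EFinP; exact: measurable_tensor.
- by move=> z _; rewrite lee_fin mulr_ge0.
- by rewrite lee_fin ltW.
under eq_integral do rewrite -EFinM.
apply: le_int_real.
- by apply: measurable_funM => //; exact: measurable_tensor.
- by apply: measurable_funM => //; exact: measurable_tensor.
- by move=> z; rewrite mulr_ge0// ?(ltW k0)// mulr_ge0.
move=> z; have [uv0|uv0] := eqVneq (u z.1 * v z.2) 0.
  by rewrite uv0 mulr0 mul0r.
rewrite mulrC; apply: ler_wpM2l; first exact: mulr_ge0.
have O1 : Omega z.1.
  by apply: contrapT => /uO E; rewrite E mul0r eqxx in uv0.
have O2 : Omega z.2.
  by apply: contrapT => /vO E; rewrite E mulr0 eqxx in uv0.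
apply: riesz_ge => //.
- move=> i; have := OM _ O1 i; have := OM _ O2 i.
  by have := ler_normB (z.1 ord0 i) (z.2 ord0 i); lra.
- by rewrite mulr_ge0// ltW.
- by apply: contra_neq uv0 => ->.
Qed.

Lemma critical_neg_source (x : R) :
  `|x| `^ (q - 2) * x * Num.max (- x) 0 = - Num.max (- x) 0 `^ q.
Proof.
case: (leP 0 x) => x0.
  by rewrite max_r ?oppr_le0// mulr0 powR0 ?gt_eqF// oppr0.
rewrite max_l; last by rewrite oppr_ge0 ltW.
rewrite mulrN critical_source_self// ltr0_norm//.
Qed.

Lemma critical_neg_balance u : critical_point s q Omega u ->
  dotG (neg u) (neg u) - dotG (pos u) (neg u) = \int[leb]_x (neg u x `^ q).
Proof.
move=> cu; have au := critical_approximable q1 oOmega bOmega cu.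
have [ap an] := (apos au, aneg au).
have := critical_weak q1 oOmega bOmega cu an.
rewrite -[X in dotG X _]pos_neg_sub dotGBl; [|exact: aF..].
rewrite (_ : \int[leb]_x (_ * _) = - \int[leb]_x (neg u x `^ q)); first by lra.
rewrite -[RHS]mulN1r -RintegralZl//; last first.
  exact: (integrable_lq q1 oOmega bOmega an (neg_ge0 u)).
by apply: eq_Rintegral => x _; rewrite critical_neg_source mulN1r.
Qed.

Lemma Rintegral_eq0_ae z : approximable z -> (forall x, 0 <= z x) ->
  \int[leb]_x z x = 0 -> {ae leb, forall x, z x = 0}.
Proof.
move=> az z0 i0; apply: ge0_int0_ae => //; first exact: aM.
by rewrite (Rintegral_EFin (L1 az)) i0.
Qed.

(** If the negative part has zero energy, the bilinear form does not see the
    difference between [u] and [|u|]. *)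
Lemma critical_norm_supersolution u : critical_point s q Omega u ->
  dotG (neg u) (neg u) = 0 -> \int[leb]_x neg u x = 0 ->
  supersolution (fun x => `|u x|).
Proof.
move=> cu d0 i0; have au := critical_approximable q1 oOmega bOmega cu.
have [ap an] := (apos au, aneg au).
have n0 := Rintegral_eq0_ae an (neg_ge0 u) i0.
split; [exact: anorm|by move=> x; exact: normr_ge0| |].
- move=> phi aphi phi0.
  have -> : dotG (fun x => `|u x|) phi = dotG u phi.
    have -> : (fun x => `|u x|) = u \+ (2 \*o neg u).
      by rewrite negE; apply/funext => x /=; lra.
    rewrite (dotGDl (aF au) (finite_energyZ 2 (aF an)) (aF aphi)).
    by rewrite (dotGZl 2 (aF an) (aF aphi)) (dotG_eq0 (aF an) (aF aphi) d0)
      mulr0 addr0.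
  rewrite (critical_weak q1 oOmega bOmega cu aphi).
  rewrite le_eqVlt; apply/orP; left; apply/eqP; rewrite /Rintegral; congr fine.
  have i1 := integrable_critical q1 oOmega bOmega au aphi.
  have i2 := integrable_source q1 oOmega bOmega au aphi.
  apply: ae_eq_integral => //;
    [by case/integrableP: i2|by case/integrableP: i1|].
  apply: filterS n0 => x nx _; congr EFin; congr (_ * _).
  have ux : 0 <= u x.
    by move/eqP: nx; rewrite /neg; case: (leP 0 (u x)) => // ux;
      rewrite max_l ?oppr_eq0 ?lt_eqF// oppr_ge0 ltW.
  rewrite ger0_norm// (_ : q - 2 = q - 1 - 1); last by ring.
  by rewrite mulrC mulr_powRB1// subr_gt0.
- rewrite -(critical_energy q1 oOmega bOmega cu).
  exact: (dotG_norm_le q1 oOmega bOmega au).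
Qed.

(** The energy is at most [(1/2 - 1/q) int z^q], and [q < 2]. *)
Lemma supersolution_energy_lt0 z : approximable z -> (forall x, 0 <= z x) ->
  dotG z z <= \int[leb]_x (z x `^ q) -> \int[leb]_x z x != 0 ->
  energy s q z < 0.
Proof.
move=> az z0 zz; rewrite /energy; apply: contra_neqP.
have I0 : 0 <= \int[leb]_x (z x `^ q).
  by apply: Rintegral_ge0 => x _; exact: powR_ge0.
have qV : q^-1 > 2^-1 by rewrite ltf_pV2 ?posrE.
move=> /negP; rewrite -leNgt => E.
have Iq : \int[leb]_x (z x `^ q) = 0.
  move: E zz I0; move: (dotG z z) (\int[leb]_x _) (q^-1) qV => a b c; nra.
have iq := integrable_lq q1 oOmega bOmega az z0.
have zq : {ae leb, forall x, z x `^ q = 0}.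
  apply: ge0_int0_ae => [|x|]; last by rewrite Rintegral_EFin// Iq.
    by apply: measurable_powR_comp; exact: aM.
  exact: powR_ge0.
rewrite /Rintegral (ae_eq_integral (cst 0%E))//= ?integral0//.
  by apply/measurable_EFinP; exact: aM.
by apply: filterS zq => x /powR_eq0_eq0 -> _.
Qed.

Lemma energy_eq0_ge0 z : approximable z -> (forall x, 0 <= z x) ->
  \int[leb]_x z x = 0 -> 0 <= energy s q z.
Proof.
move=> az z0 i0; have ae0 := Rintegral_eq0_ae az z0 i0.
have I0 : \int[leb]_x (z x `^ q) = 0.
  rewrite /Rintegral (ae_eq_integral (cst 0%E))//= ?integral0//.
    by apply/measurable_EFinP; apply: measurable_powR_comp; exact: aM.
  by apply: filterS ae0 => x -> _; rewrite powR0// gt_eqF.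
by rewrite /energy I0 mulr0 subr0 mulr_ge0// dotG_ge0.
Qed.

Lemma Rintegral_neq0 z : approximable z -> \int[leb]_x z x != 0 ->
  (\int[leb]_x (z x)%:E != 0)%E.
Proof. by move=> az; rewrite (Rintegral_EFin (L1 az)) eqe. Qed.

Lemma density_norm_supersolution w : lane_emden_density s q Omega w ->
  supersolution (fun x => `|w x|).
Proof.
move=> dw; have aw := density_approximable q1 oOmega bOmega dw.
exact: (minimiser_supersolution q1 oOmega bOmega (anorm aw)
  (fun x => normr_ge0 (w x)) (density_norm_min q1 oOmega bOmega dw)).
Qed.

Lemma density_ae_eq w w' : lane_emden_density s q Omega w ->
  lane_emden_density s q Omega w' -> \int[leb]_x `|w x| != 0 ->
  {ae leb, forall x, w' x = `|w x|}.
Proof.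
move=> dw dw' wn0.
have [aw aw'] := (density_approximable q1 oOmega bOmega dw,
  density_approximable q1 oOmega bOmega dw').
have [sw sw'] := (density_norm_supersolution dw, density_norm_supersolution
  dw').
have [_ _ _ ww] := sw.
have Ew := supersolution_energy_lt0 (anorm aw) (fun x => normr_ge0 (w x)) ww
  wn0.
have Ew' := density_norm_min q1 oOmega bOmega dw' (anorm aw)
  (fun x => normr_ge0 (w x)).
have w'n0 : \int[leb]_x `|w' x| != 0.
  apply/eqP => i0.
  have := energy_eq0_ge0 (anorm aw') (fun x => normr_ge0 (w' x)) i0.
  by rewrite leNgt (le_lt_trans Ew' Ew).
have ae1 := supersolution_unique q1 q2 oOmega bOmega sw' sw
  (Rintegral_neq0 (anorm aw') w'n0) (Rintegral_neq0 (anorm aw) wn0).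
have [[Dw' w'pos] _] := dw'.
by apply: filterS2 ae1 (density_ae_norm Dw' w'pos) => x <- <-.
Qed.

Lemma integral_Omega_dist u w z : approximable u -> approximable w ->
  approximable z -> {ae leb, forall x, w x = z x} ->
  (\int[leb]_(x in Omega) `|u x - w x|%:E)%E =
  (\int[leb]_x `|u x - z x|)%:E.
Proof.
move=> au aw az wz; have [[_ uO _] [_ wO _]] := (au, aw).
rewrite (integral_Omega (F := fun x => `|u x - w x|)); last first.
  by move=> x nx; rewrite uO// wO// subrr normr0.
rewrite -(Rintegral_EFin (L1 (anorm (aB au az)))).
apply: ae_eq_integral => //.
- by apply/measurable_EFinP; apply: (aM (anorm (aB au aw))).
- by apply/measurable_EFinP; apply: (aM (anorm (aB au az))).
- by apply: filterS wz => x -> _.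
Qed.

(** If [int |u - z| <= I / 2], where [I = int z], then [int u^+ >= I / 2],
    because [z <= u^+ + |u - z|]; and [u^- <= |u - z|] because [z >= 0]. *)
Lemma critical_close_eq : forall z, supersolution z -> \int[leb]_x z x != 0 ->
  exists2 delta : R, 0 < delta & forall u, critical_point s q Omega u ->
    \int[leb]_x `|u x - z x| < delta -> {ae leb, forall x, u x = z x}.
Proof.
move=> z sz zn0; have [az z0 _ zz] := sz.
have I0 : 0 < \int[leb]_x z x.
  by rewrite lt_neqAle eq_sym zn0/=; exact: Rintegral_ge0.
have [k k0 kP] := interaction_lower_bound.
set I := \int[leb]_x z x in I0 *.
have c0 : 0 < k * (I / 2) by rewrite mulr_gt0// divr_gt0.
have [d d0 dP] := small_mass N1 s0 q1 q2 oOmega bOmega c0.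
exists (Num.min d (I / 2)); first by rewrite lt_min d0 divr_gt0.
move=> u cu; rewrite lt_min => /andP[ud uI].
have au := critical_approximable q1 oOmega bOmega cu.
have [ap an] := (apos au, aneg au).
have iD := L1 (anorm (aB au az)).
have negd : \int[leb]_x neg u x <= \int[leb]_x `|u x - z x|.
  apply: le_Rintegral => //; first exact: L1.
  move=> x _; rewrite /neg ge_max normr_ge0 andbT.
  by rewrite distrC; apply: le_trans (ler_norm _); rewrite lerDr.
have posd : I / 2 <= \int[leb]_x pos u x.
  have : I <= \int[leb]_x (pos u x + `|u x - z x|).
    apply: le_Rintegral => //; first exact: L1.
      exact: (integrableD measurableT (L1 ap) iD).
    move=> x _; have : u x <= pos u x by rewrite /pos le_max lexx.
    by have := ler_norm (z x - u x); rewrite distrC; lra.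
  rewrite RintegralD//; last exact: L1.
  move: uI; lra.
have bal := critical_neg_balance cu.
have inter := kP _ _ ap an (pos_ge0 u) (neg_ge0 u) (pos_neg_mul u).
have M0 : 0 <= \int[leb]_x neg u x by apply: Rintegral_ge0 => x _;
  exact: neg_ge0.
have [||n0 in0] := dP _ an (neg_ge0 u).
- by apply: le_trans negd _; exact: ltW.
- rewrite -bal lerD2l; apply: le_trans inter.
  by rewrite -mulrA ler_wpM2l ?(ltW k0)// ler_wpM2r.
have su := critical_norm_supersolution cu n0 in0.
have un0 : \int[leb]_x `|u x| != 0.
  rewrite gt_eqF//; apply: (@lt_le_trans _ _ (I / 2));
    first by rewrite divr_gt0.
  apply: le_trans posd _; apply: le_Rintegral => //;
    [exact: L1|exact: L1 (anorm au)|].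
  by move=> x _; rewrite /pos ge_max ler_norm normr_ge0.
have ae1 := supersolution_unique q1 q2 oOmega bOmega su sz
  (Rintegral_neq0 (anorm au) un0) (Rintegral_neq0 az zn0).
apply: filterS2 ae1 (Rintegral_eq0_ae an (neg_ge0 u) in0) => x <-.
rewrite /neg; case: (leP 0 (u x)) => ux; first by rewrite ger0_norm.
by rewrite max_l ?oppr_ge0 ?ltW// => /eqP; rewrite oppr_eq0 lt_eqF.
Qed.

End isolation.

Theorem proposition7p4 (R : realType) (N : nat) (s q : R)
    (Omega : set 'rV[R]_N) :
  (1 <= N)%N -> 0 < s < 1 -> 1 < q < 2 ->
  open Omega -> bounded_set Omega -> C11_boundary Omega ->
  exists delta : R, 0 < delta /\
    forall w u : 'rV[R]_N -> R,
      lane_emden_density s q Omega w ->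
      critical_point s q Omega u ->
      ~ ae_eq (lebesgue_rV N) Omega u w ->
      (delta%:E <= \int[lebesgue_rV N]_(x in Omega) `|u x - w x|%:E)%E.
Proof.
move=> N1 /andP[s0 _] /andP[q1 q2] oO bO _.
have [[w0 [dw0 w0n0]]|nontriv] := pselect (exists w0,
    lane_emden_density s q Omega w0 /\ \int[lebesgue_rV N]_x `|w0 x| != 0).
  have [d d0 dP] := critical_close_eq N1 s0 q1 q2 oO bO
    (density_norm_supersolution q1 oO bO dw0) w0n0.
  exists d; split=> // w u dw cu nuw.
  have ww0 := density_ae_eq q1 q2 oO bO dw0 dw w0n0.
  rewrite (integral_Omega_dist q1 oO bO (critical_approximable q1 oO bO cu)
    (density_approximable q1 oO bO dw)
    (approximable_norm q1 oO bO (density_approximable q1 oO bO dw0)) ww0)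
      lee_fin.
  rewrite leNgt; apply/negP => /(dP _ cu) uw0; apply: nuw.
  by apply: filterS2 uw0 ww0 => x -> -> _.
exists 1; split=> // w u dw cu nuw; exfalso; apply: nuw.
have aw := density_approximable q1 oO bO dw.
have au := critical_approximable q1 oO bO cu.
have iw : \int[lebesgue_rV N]_x `|w x| = 0.
  by apply/eqP; apply: contrapT => /negP wn0; apply: nontriv; exists w.
have w0 := Rintegral_eq0_ae q1 oO bO (approximable_norm q1 oO bO aw)
  (fun x => normr_ge0 (w x)) iw.
have iu : \int[lebesgue_rV N]_x `|u x| = 0.
  apply/eqP; apply: contrapT => /negP un0.
  have uu := dotG_norm_le q1 oO bO au.
  rewrite (critical_energy q1 oO bO cu) in uu.
  have Eu := supersolution_energy_lt0 q1 q2 oO bO (approximable_norm q1 oO bO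
    au)
    (fun x => normr_ge0 (u x)) uu un0.
  have Ew := density_norm_min q1 oO bO dw (approximable_norm q1 oO bO au)
    (fun x => normr_ge0 (u x)).
  have := energy_eq0_ge0 q1 oO bO (approximable_norm q1 oO bO aw)
    (fun x => normr_ge0 (w x)) iw.
  by rewrite leNgt (le_lt_trans Ew Eu).
have u0 := Rintegral_eq0_ae q1 oO bO (approximable_norm q1 oO bO au)
  (fun x => normr_ge0 (u x)) iu.
by apply: filterS2 u0 w0 => x /eqP; rewrite normr_eq0 => /eqP ->
  /eqP; rewrite normr_eq0 => /eqP ->.
Qed.
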